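(* There exist absolute constants $c,C\in(0,\infty)$ such that the following holds. Let $\alpha>\tfrac12$ and $\delta\in(-1,0)$ be fixed real numbers, and let $A(\delta,\alpha)=A(\delta,\alpha;n)=\sqrt{4(1+\delta)\alpha\log n/n}$. Then $$\lim_{n\to\infty}\frac{\log\big(1-\mathcal{R}_n(A(\delta,\alpha))\big)}{\log n}=\frac12-\alpha .$$ Moreover, there is $n_0(\alpha,\delta)<\infty$ such that for all $n\ge n_0(\alpha,\delta)$, $$c\le\frac{1-\mathcal{R}_n(A(\delta,\alpha))}{\sqrt{(1+\delta)\alpha}\;n^{1/2-\alpha}\sqrt{\log n}}\le C .$$
   Context: For positive integers $n\le N$ and a real number $A\ge 0$, let $\Theta(A,n,N)$ be the set of matrices $\boldsymbol{\theta}=(\theta_{ij})\in\mathbb{R}^{N\times N}$ for which there exist $R,C\subset\{1,\dots,N\}$ with $|R|=|C|=n$ such that $\theta_{ij}\ge A$ for all $(i,j)\in R\times C$ and $\theta_{ij}=0$ for all other $(i,j)$. For $\boldsymbol{\theta}\in\mathbb{R}^{N\times N}$ let $\mathbb{P}_{\boldsymbol{\theta}}$ denote the law of a random matrix $\mathbf{X}=(X_{ij})_{1\le i,j\le N}$ with independent entries $X_{ij}\sim N(\theta_{ij},1)$, and let $\mathbb{P}_0$ be this law for $\boldsymbol{\theta}=\mathbf{0}$. A test is a measurable function $T=T(\mathbf{X})$ with values in $\{0,1\}$. The minimax risk is $$\mathcal{R}_{n,N}(A)=\inf_{T}\Big\{\mathbb{P}_0(T=1)+\sup_{\boldsymbol{\theta}\in\Theta(A,n,N)}\mathbb{P}_{\boldsymbol{\theta}}(T=0)\Big\},$$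 the infimum being over all tests. For fixed $\alpha>0$ put $N=\lfloor n^{1+\alpha}\rfloor$ and $\mathcal{R}_n(A)=\mathcal{R}_{n,\lfloor n^{1+\alpha}\rfloor}(A)$. ''Absolute constants'' means constants not depending on $\alpha$, $\delta$ or $n$. *)

(* Defs.v *)
From HB Require Import structures.
From mathcomp Require Import all_boot all_order all_algebra.
From mathcomp Require Import all_classical all_reals all_analysis.

Set Implicit Arguments.
Unset Strict Implicit.
Unset Printing Implicit Defensive.
Import Order.TTheory GRing.Theory Num.Theory.
Import numFieldNormedType.Exports.

Local Open Scope classical_set_scope.
Local Open Scope ring_scope.

Section tuple_product.
Context d (T : measurableType d) (R : realType).

Definition tuple_cons n (x : T * n.-tuple T) : n.+1.-tuple T :=
  [the n.+1.-tuple T of x.1 :: x.2].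

Lemma measurable_tuple_cons n : measurable_fun setT (@tuple_cons n).
Proof. exact: measurable_cons. Qed.

HB.instance Definition _ n :=
  isMeasurableFun.Build _ _ _ _ (@tuple_cons n) (@measurable_tuple_cons n).

(* The product of P 0, ..., P (n - 1), i.e. the law of a tuple of independent
   entries with these marginals; tuple_productE is its defining property. *)
Fixpoint tuple_product (n : nat) :
    ('I_n -> probability T R) -> probability (n.-tuple T) R :=
  match n with
  | 0 => fun _ => (\d_ ([tuple] : 0.-tuple T) : probability _ R)
  | m.+1 => fun P =>
      (distribution
         (P ord0 \x tuple_product (fun i => P (lift ord0 i)) : probability _ R)%E
         (@tuple_cons m) : probability _ R)
  end.

Lemma measurable_box n (B : 'I_n -> set T) :
  (forall i, measurable (B i)) ->
  measurable [set x : n.-tuple T | forall i, B i (tnth x i)].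
Proof.
move=> mB.
have -> : [set x : n.-tuple T | forall i, B i (tnth x i)] =
    \bigcap_(i in [set: 'I_n]) ((@tnth n T ^~ i) @^-1` B i).
  apply/seteqP; split => [x /= H i _|x /= H i]; first exact: H.
  exact: (H i).
apply: fin_bigcap_measurable => // i _.
by rewrite -[_ @^-1` _]setTI; exact: measurable_tnth.
Qed.

Lemma tuple_productE n (P : 'I_n -> probability T R) (B : 'I_n -> set T) :
  (forall i, measurable (B i)) ->
  (tuple_product P [set x | forall i, B i (tnth x i)] = \prod_(i < n) P i (B i))%E.
Proof.
elim: n P B => [|n IHn] P B mB.
  rewrite big_ord0 /= diracE mem_set//.
  by case.
rewrite big_ord_recl /= /distribution /pushforward.
have -> : @tuple_cons n @^-1` [set x | forall i, B i (tnth x i)] =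
  B ord0 `*` [set x | forall i, B (lift ord0 i) (tnth x i)].
  apply/seteqP; split => [[x t] /= H|[x t] /= [H0 H] i].
    split; first exact: (H ord0).
    by move=> i; move: (H (lift ord0 i)); rewrite tnthS.
  by case: (unliftP ord0 i) => [j ->|->]; rewrite ?tnthS.
have mB' := @measurable_box n (fun i => B (lift ord0 i)) (fun i => mB (lift ord0 i)).
rewrite product_measure1E//.
by congr (_ * _)%E; apply: IHn => i; exact: mB.
Qed.

End tuple_product.

Section submatrix_detection.
Variable R : realType.

(* The N x N real matrices given as tuples of rows: unlike 'M[R]_N, this type
   carries a sigma-algebra (the Borel one). *)
Notation matrix_space N := (N.-tuple (N.-tuple (measurableTypeR R))).

Definition gaussian_matrix_law (N : nat) (theta : 'M[R]_N) :
    probability (matrix_space N) R :=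
  tuple_product (fun i => tuple_product (fun j => normal_prob (theta i j) 1)).

Definition Theta (A : R) (n N : nat) : set 'M[R]_N :=
  [set theta | exists Rw Cl : {set 'I_N},
    [/\ #|Rw| = n, #|Cl| = n,
        (forall i j, i \in Rw -> j \in Cl -> A <= theta i j) &
        (forall i j, ~~ ((i \in Rw) && (j \in Cl)) -> theta i j = 0)]].

Local Open Scope ereal_scope.

(* A test is a measurable function to bool, with true for the value 1. *)
Definition test_risk (A : R) (n N : nat)
    (T : {mfun matrix_space N >-> bool}) : \bar R :=
  gaussian_matrix_law (0%R : 'M[R]_N) [set X | T X = true] +
  ereal_sup [set gaussian_matrix_law theta [set X | T X = false]
            | theta in @Theta A n N].

Definition minimax_risk (A : R) (n N : nat) : \bar R :=
  ereal_inf [set test_risk A n T | T in [set: {mfun matrix_space N >-> bool}]].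

(* truncn is the floor, as the power is nonnegative. *)
Definition ambient_dim (alpha : R) (n : nat) : nat :=
  Num.truncn (n%:R `^ (1 + alpha))%R.

(* For alpha > 0 and A >= 0 we have n <= ambient_dim alpha n, so Theta is
   nonempty, the minimax risk lies in [0, 1], and fine loses nothing. *)
Definition poly_risk (alpha : R) (n : nat) (A : R) : R :=
  fine (minimax_risk A n (ambient_dim alpha n)).

End submatrix_detection.

Definition signal_level (R : realType) (delta alpha : R) (n : nat) : R :=
  Num.sqrt (4 * (1 + delta) * alpha * ln n%:R / n%:R).

(* Main.v *)
Require Import Defs.
From HB Require Import structures.
From mathcomp Require Import all_boot all_order all_algebra.
From mathcomp Require Import all_classical all_reals all_analysis.
From mathcomp Require Import measurable_realfun ring lra.

(** Write b = (1 + delta) alpha, l = log n, A^2 = 4 b l / n and N ~ n^(1 + alpha).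
Both bounds say that 1 - R is of the order of A n^2 / N, which is
2 sqrt b n^(1/2 - alpha) sqrt l up to rounding; the limit follows by taking
logarithms, since log log n is negligible against log n.

Lower bound on 1 - R (minimax_risk_le_sum_test). The test rejects when the sum
of all the entries is positive. That sum is normal with standard deviation N
and mean 0 under the null, at least A n^2 under the alternative, so the two
errors add up to at most 1 minus a constant times A n^2 / N as soon as this ratio is
bounded. The law of the sum comes from normal_convolution.

Upper bound on 1 - R (minimax_risk_lower). The supremum over Theta is at least
an average over a finite prior. Cut {0, ..., n m - 1}, where m = N / n rounded
down, into n blocks of m indices; a function f from blocks to positions selects one row per block, and g
one column per block. The signal is A on the selected submatrix. With L the
average of the likelihood ratios, each truncated to the event that the linear
statistic of its own signal is at most (1 + e) times its mean, the
inequality 1 - L <= s / 2 + (1 - L)^2 / (2 s) bounds 1 - R by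
s / 2 + (E L^2 - 2 E L + 1) / (2 s) for every s > 0 (mixture_lower_bound). The
truncation removes mass exp (- e^2 A^2 n^2 / 2) only (truncation_prob).

Two independent signals share k rows and k' columns, and k, k' are
independent binomial(n, 1 / m). Their term in E L^2 is at most the smaller of
exp (A^2 k k') and exp ((1 + 2 e) A^2 n^2 k k' / (n^2 + k k')); the second
bound uses the truncation (truncated_pair_moment). If A^2 k k' <= 1/2 the first
one is at most 1 + 2 A^2 k k', whose average is 1 + 2 s^2 with s = A n / m. All
other overlaps are negligible by the Chernoff bound
P(overlap = k) <= (exp(1) n / (k m))^k (sum_overlap_weight, large_overlaps_bound).
Let k' <= k. If k' is a small fraction of n, then k >= sqrt (n / (8 b l)), hence, alpha being
above 1/2, the probability of the overlap k is at most n^(- c k) and beats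
exp (A^2 k k') = n^(4 b k k' / n). If k and k' are both of order n, the inequality
4 n k k' <= (k + k') (n^2 + k k') bounds the second exponent by
(1 + 2 e) (1 + delta) alpha l (k + k'), and for small e this is less than the
alpha l (k + k') gained from the probabilities. Here delta < 0 is used; without
the truncation the argument would need delta < - 1/2. *)

Set Implicit Arguments.
Unset Strict Implicit.
Unset Printing Implicit Defensive.

Import Order.TTheory GRing.Theory Num.Theory.
Import numFieldNormedType.Exports HBNNSimple.

Local Open Scope classical_set_scope.
Local Open Scope ring_scope.

(** * Densities *)

Section densities.
Context {d : measure_display} {T : measurableType d} {R : realType}.
Local Open Scope ereal_scope.

(** The change of variables is required for all nonnegative functions rather
than for sets, the form that iterates along a product measure. *)
Definition has_density (mu nu : {measure set T -> \bar R}) (g : T -> R) :=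
  forall h : T -> \bar R, measurable_fun setT h -> (forall x, 0 <= h x) ->
  \int[nu]_x h x = \int[mu]_x (h x * (g x)%:E).

(** Both sides are linear and continuous along increasing sequences in h, so
simple functions, and thus indicators, suffice. *)
Lemma has_density_of_sets (mu nu : {measure set T -> \bar R}) (g : T -> R) :
  measurable_fun setT g -> (forall x, 0 <= g x)%R ->
  (forall B, measurable B -> nu B = \int[mu]_(x in B) (g x)%:E) ->
  has_density mu nu g.
Proof.
move=> mg g0 nuE h mh h0.
have mgE : measurable_fun setT (EFin \o g) by exact/measurable_EFinP.
have scaledE (r : R) B : measurable B -> (0 <= r)%R ->
    \int[nu]_x (r * \1_B x)%:E = \int[mu]_x ((r * \1_B x)%:E * (g x)%:E).
  move=> mB r0.
  under eq_integral do rewrite EFinM.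
  under [RHS]eq_integral do rewrite EFinM -muleA.
  rewrite !ge0_integralZl//=; last 3 first.
  - by apply: emeasurable_funM => //; apply/measurable_EFinP; exact: measurable_indic.
  - by move=> x _; rewrite mule_ge0// lee_fin.
  - by apply/measurable_EFinP; exact: measurable_indic.
  congr (_ * _); rewrite integral_indic// setIT nuE// integral_mkcond.
  apply: eq_integral => x _; rewrite patchE indicE.
  by case: (x \in B); rewrite ?mul1e ?mul0e.
have sfunE (f : {nnsfun T >-> R}) :
    \int[nu]_x (f x)%:E = \int[mu]_x ((f x)%:E * (g x)%:E).
  transitivity (\sum_(y \in range f) \int[nu]_x (y * \1_(f @^-1` [set y]) x)%:E).
    under eq_integral do rewrite fimfunE -fsumEFin//.
    rewrite ge0_integral_fsum//.
    - by move=> y; exact/measurable_EFinP/measurable_funM.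
    - by move=> y x _; rewrite nnfun_muleindic_ge0.
  transitivity (\sum_(y \in range f)
      \int[mu]_x ((y * \1_(f @^-1` [set y]) x)%:E * (g x)%:E)).
    apply: eq_fsbigr => y; rewrite inE => -[t _ <-].
    by apply: scaledE => //; exact: fun_ge0.
  rewrite -ge0_integral_fsum//; last 2 first.
  - move=> y; apply: emeasurable_funM => //.
    exact/measurable_EFinP/measurable_funM.
  - by move=> y x _; rewrite mule_ge0 ?lee_fin// -lee_fin EFinM nnfun_muleindic_ge0.
  apply: eq_integral => x _; rewrite -ge0_mule_fsuml.
    by rewrite fsumEFin// -fimfunE.
  by move=> y; rewrite EFinM nnfun_muleindic_ge0.
pose f_ := nnsfun_approx measurableT mh.
transitivity (limn (fun n => \int[nu]_x (f_ n x)%:E)).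
  rewrite -monotone_convergence//=.
  - apply: eq_integral => x _; apply/esym/cvg_lim => //.
    exact: cvg_nnsfun_approx.
  - by move=> n; exact/measurable_EFinP.
  - by move=> n x _; rewrite lee_fin.
  - by move=> x _ a b ab; rewrite lee_fin; exact/lefP/nd_nnsfun_approx.
rewrite (_ : (fun n => _) = fun n => \int[mu]_x ((f_ n x)%:E * (g x)%:E)); last first.
  by apply/funext => n; rewrite sfunE.
rewrite -monotone_convergence//=.
- apply: eq_integral => x _; apply/cvg_lim => //.
  under eq_fun do rewrite muleC.
  rewrite muleC; apply: cvgeZl => //.
  exact: cvg_nnsfun_approx.
- by move=> n; apply: emeasurable_funM => //; exact/measurable_EFinP.
- by move=> n x _; rewrite mule_ge0 ?lee_fin.
- move=> x _ a b ab; rewrite lee_wpmul2r ?lee_fin//.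
  exact/lefP/nd_nnsfun_approx.
Qed.

End densities.

(** * Integration over products of probabilities *)

Section tuple_products.
Context {d : measure_display} {T : measurableType d} {R : realType}.
Local Open Scope ereal_scope.

Lemma integral_tuple_product0 (P : 'I_0 -> probability T R)
    (h : 0.-tuple T -> \bar R) : measurable_fun setT h ->
  \int[tuple_product P]_x h x = h [tuple].
Proof. by move=> mh; rewrite /= integral_dirac// diracT mul1e. Qed.

(** Tonelli, through the bijection between tuples and head-tail pairs. *)
Lemma integral_tuple_productS (n : nat) (P : 'I_n.+1 -> probability T R)
    (h : n.+1.-tuple T -> \bar R) :
  measurable_fun setT h -> (forall x, 0 <= h x) ->
  \int[tuple_product P]_x h x =
  \int[P ord0]_x \int[tuple_product (fun i => P (lift ord0 i))]_t
    h (tuple_cons (x, t)).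
Proof.
move=> mh h0.
rewrite /= ge0_integral_distribution// fubini_tonelli1//=.
by apply: measurableT_comp => //; exact: measurable_tuple_cons.
Qed.

Lemma measurable_integral_tuple_cons (n : nat) (P : 'I_n -> probability T R)
    (h : n.+1.-tuple T -> \bar R) :
  measurable_fun setT h -> (forall x, 0 <= h x) ->
  measurable_fun setT
    (fun x => \int[tuple_product P]_t h (tuple_cons (x, t))).
Proof.
move=> mh h0.
apply: (@measurable_fun_fubini_tonelli_F _ _ _ _ R (tuple_product P)
  (h \o @tuple_cons _ T n)); last by move=> x; exact: h0.
apply: measurableT_comp => //; exact: measurable_tuple_cons.
Qed.

Lemma measurable_prod_tnth (n : nat) (g : 'I_n -> T -> R) :
  (forall i, measurable_fun setT (g i)) ->
  measurable_fun setT (fun x : n.-tuple T => \prod_(i < n) g i (tnth x i))%R.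
Proof.
move=> mg; apply: measurable_prod => i _.
by apply: measurableT_comp => //; exact: measurable_tnth.
Qed.

Lemma measurable_sum_tnth (n : nat) (g : 'I_n -> T -> R) :
  (forall i, measurable_fun setT (g i)) ->
  measurable_fun setT (fun x : n.-tuple T => \sum_(i < n) g i (tnth x i))%R.
Proof.
move=> mg; apply: measurable_sum => i.
by apply: measurableT_comp => //; exact: measurable_tnth.
Qed.

(** Integrating out the first coordinate turns the density of its law into a
factor; the remaining coordinates are the induction hypothesis. *)
Lemma has_density_tuple_product (n : nat) (P Q : 'I_n -> probability T R)
    (g : 'I_n -> T -> R) :
  (forall i, measurable_fun setT (g i)) -> (forall i x, 0 <= g i x)%R ->
  (forall i, has_density (P i) (Q i) (g i)) ->
  has_density (tuple_product P) (tuple_product Q)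
    (fun x => \prod_(i < n) g i (tnth x i))%R.
Proof.
elim: n P Q g => [|n IHn] P Q g mg g0 dQ h mh h0.
  rewrite !integral_tuple_product0//; last first.
    by apply: emeasurable_funM => //; apply/measurable_EFinP; exact: measurable_prod_tnth.
  by rewrite big_ord0 mule1.
have mhg : measurable_fun setT (fun x : n.+1.-tuple T =>
    h x * (\prod_(i < n.+1) g i (tnth x i))%:E).
  by apply: emeasurable_funM => //; apply/measurable_EFinP; exact: measurable_prod_tnth.
have p0 k (f : 'I_k -> T -> R) (x : k.-tuple T) : (forall i y, 0 <= f i y)%R ->
    0 <= (\prod_(i < k) f i (tnth x i))%:E.
  by move=> f0; rewrite lee_fin prodr_ge0.
rewrite !integral_tuple_productS//; last by move=> x; rewrite mule_ge0// p0.
rewrite (dQ ord0)//; last 2 first.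
  - exact: measurable_integral_tuple_cons.
  - by move=> x; exact: integral_ge0.
apply: eq_integral => x _.
have mhx : measurable_fun setT (fun t => h (tuple_cons (x, t))).
  apply: measurableT_comp => //.
  apply: (measurableT_comp (@measurable_tuple_cons _ T n)).
  exact: pair1_measurable.
pose g' i := g (lift ord0 i).
rewrite (IHn _ _ g' (fun i => mg _) (fun i => g0 _) (fun i => dQ _))//.
rewrite muleC -ge0_integralZl//; last 3 first.
  - apply: emeasurable_funM => //; apply/measurable_EFinP.
    by apply: measurable_prod_tnth => i; exact: mg.
  - by move=> t _; rewrite mule_ge0// p0// => i y; exact: g0.
  - by rewrite lee_fin.
apply: eq_integral => t _.
rewrite big_ord_recl EFinM muleCA; congr (_ * (_%:E * _%:E)).
apply: eq_bigr => i _; by rewrite /g' /= tnthS.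
Qed.

End tuple_products.

(** * Sums of independent normal variables *)

Section gaussian.
Context {R : realType}.
Notation mu := (@lebesgue_measure R).

Lemma normal_prob_density (m s : R) :
  has_density mu (normal_prob m s) (normal_pdf m s).
Proof.
apply: has_density_of_sets => //; first exact: measurable_normal_pdf.
exact: normal_pdf_ge0.
Qed.

Lemma integral_normal_prob (m s : R) (h : R -> \bar R) :
  measurable_fun setT h -> (forall x, 0 <= h x)%E ->
  (\int[normal_prob m s]_x h x = \int[mu]_x (h x * (normal_pdf m s x)%:E))%E.
Proof. exact: normal_prob_density. Qed.

(** Lebesgue measure and its image under a translation agree on half-open
intervals, which determine it. *)
Lemma lebesgue_integral_shift (a : R) (h : R -> \bar R) :
  measurable_fun setT h -> (forall x, 0 <= h x)%E ->
  (\int[mu]_x h (x + a)%R = \int[mu]_x h x)%E.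
Proof.
move=> mh h0.
pose phi (x : measurableTypeR R) : measurableTypeR R := (x : R) + a.
have mphi : measurable_fun setT phi by exact: measurable_funD.
pose f : {mfun measurableTypeR R >-> measurableTypeR R} :=
  HB.pack phi (isMeasurableFun.Build _ _ _ _ _ mphi).
have nuE : forall A, measurable A -> mu A = pushforward mu f A.
  apply: lebesgue_measure_unique => X [[x y] /= _ <-].
  rewrite /pushforward.
  have -> : f @^-1` `]x, y]%classic = `]x - a, y - a]%classic.
    by apply/seteqP; split => z /=; rewrite !in_itv/= ltrBlDr lerBrDr.
  rewrite !lebesgue_measure_itv/= !lte_fin ltrD2r; case: ifPn => // _.
  by rewrite -!EFinD; congr EFin; ring.
rewrite [RHS](eq_measure_integral (pushforward mu f)) => [|A mA _].
  by rewrite ge0_integral_pushforward//.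
exact: nuE.
Qed.

(** Completing the square: the joint density of two independent normal
variables is the density of their sum times a conditional normal density. *)
Lemma normal_pdf_mul (m1 s1 m2 s2 x y : R) : 0 < s1 -> 0 < s2 ->
  normal_pdf m1 s1 x * normal_pdf m2 s2 (y - x) =
  normal_pdf (m1 + m2) (Num.sqrt (s1 ^+ 2 + s2 ^+ 2)) y *
  normal_pdf (m1 + (y - m1 - m2) * s1 ^+ 2 / (s1 ^+ 2 + s2 ^+ 2))
    (s1 * s2 / Num.sqrt (s1 ^+ 2 + s2 ^+ 2)) x.
Proof.
move=> s10 s20.
have v0 : 0 < s1 ^+ 2 + s2 ^+ 2 by rewrite addr_gt0// exprn_gt0.
set s := Num.sqrt _.
have s0 : 0 < s by rewrite sqrtr_gt0.
have sE : s ^+ 2 = s1 ^+ 2 + s2 ^+ 2 by rewrite sqr_sqrtr// ltW.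
have t0 : 0 < s1 * s2 / s by rewrite divr_gt0// mulr_gt0.
rewrite !normal_pdfE ?gt_eqF// /normal_fun.
rewrite mulrACA [RHS]mulrACA -!expRD; congr (_ * expR _).
  rewrite /normal_peak -!invfM; congr (_^-1).
  rewrite -!sqrtrM; last 2 first.
    by rewrite mulrn_wge0// mulr_ge0 ?sqr_ge0// pi_ge0.
    by rewrite mulrn_wge0// mulr_ge0 ?sqr_ge0// pi_ge0.
  congr Num.sqrt; rewrite expr_div_n exprMn.
  by field; rewrite gt_eqF.
have s1n : s1 != 0 by rewrite gt_eqF.
have s2n : s2 != 0 by rewrite gt_eqF.
have sn : s != 0 by rewrite gt_eqF.
rewrite -!sE.
have -> : (s1 * s2 / s) ^+ 2 = s1 ^+ 2 * s2 ^+ 2 / (s1 ^+ 2 + s2 ^+ 2).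
  by rewrite expr_div_n exprMn -sE.
rewrite sE; field.
by rewrite s1n s2n !gt_eqF.
Qed.

Lemma measurable_integral_add (nu : {sigma_finite_measure set (measurableTypeR R) -> \bar R})
    (h : R -> \bar R) :
  measurable_fun setT h -> (forall x, 0 <= h x)%E ->
  measurable_fun setT (fun x : R => \int[nu]_y h (x + y)%R)%E.
Proof.
move=> mh h0.
apply: (@measurable_fun_fubini_tonelli_F _ _ (measurableTypeR R) (measurableTypeR R)
  R nu (fun p => h (p.1 + p.2)%R)) => //.
apply: (measurableT_comp mh).
exact: measurable_funD.
Qed.

(** After a translation of the inner variable and Tonelli, normal_pdf_mul leaves
an integral of a normal density over x, which is 1. *)
Lemma normal_convolution (m1 s1 m2 s2 : R) (h : R -> \bar R) :
  0 < s1 -> 0 < s2 -> measurable_fun setT h -> (forall x, 0 <= h x)%E ->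
  (\int[normal_prob m1 s1]_x \int[normal_prob m2 s2]_y h (x + y)%R =
   \int[normal_prob (m1 + m2) (Num.sqrt (s1 ^+ 2 + s2 ^+ 2))]_y h y)%E.
Proof.
move=> s10 s20 mh h0.
have pdfm m s (f : R * R -> R) : measurable_fun setT f ->
    measurable_fun setT (fun p => (normal_pdf m s (f p))%:E).
  move=> mf; apply/measurable_EFinP.
  by apply: measurableT_comp => //; exact: measurable_normal_pdf.
have pdf0 m s x : (0 <= (normal_pdf m s x : R)%:E)%E.
  by rewrite lee_fin normal_pdf_ge0.
have pdfmE m s : measurable_fun setT (fun x : R => (normal_pdf m s x)%:E).
  by apply/measurable_EFinP; exact: measurable_normal_pdf.
have inner x : (\int[normal_prob m2 s2]_y h (x + y)%R =
    \int[mu]_y (h y * (normal_pdf m2 s2 (y - x)%R)%:E))%E.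
  have mhx : measurable_fun setT (fun y : R => h (x + y)%R).
    by apply: (measurableT_comp mh); exact: measurable_funD.
  rewrite (integral_normal_prob m2 s2 mhx (fun y => h0 (x + y))).
  rewrite -(@lebesgue_integral_shift x (fun y => h y * (normal_pdf m2 s2 (y - x)%R)%:E)%E).
  - by apply: eq_integral => y _; rewrite addrK addrC.
  - apply: emeasurable_funM => //; apply/measurable_EFinP.
    by apply: (measurableT_comp (measurable_normal_pdf _ _)); exact: measurable_funB.
  - by move=> y; rewrite mule_ge0.
rewrite (integral_normal_prob m1 s1
  (measurable_integral_add (normal_prob m2 s2) mh h0)); last first.
  by move=> x; apply: integral_ge0 => y _; exact: h0.
rewrite (integral_normal_prob _ _ mh h0).
set s := Num.sqrt _.
transitivity (\int[mu]_x \int[mu]_y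
    (h y * ((normal_pdf m2 s2 (y - x)%R)%:E * (normal_pdf m1 s1 x)%:E)))%E.
  apply: eq_integral => x _; rewrite inner muleC -ge0_integralZl.
  - by apply: eq_integral => y _; rewrite muleC muleA.
  - exact: measurableT.
  - apply: emeasurable_funM; first exact: mh.
    apply/measurable_EFinP.
    by apply: (measurableT_comp (measurable_normal_pdf _ _)); exact: measurable_funB.
  - by move=> y _; rewrite mule_ge0.
  - exact: pdf0.
pose f (p : measurableTypeR R * measurableTypeR R) : \bar R :=
  (h p.2 * ((normal_pdf m2 s2 (p.2 - p.1 : R)%R)%:E * (normal_pdf m1 s1 p.1)%:E))%E.
rewrite (fubini_tonelli f); last 2 first.
- apply: emeasurable_funM; first exact: measurableT_comp.
  apply: emeasurable_funM; last exact: pdfm.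
  apply: pdfm; exact: measurable_funB.
- by move=> p; rewrite !mule_ge0.
apply: eq_integral => y _; rewrite /f /=.
under eq_integral do rewrite -EFinM mulrC normal_pdf_mul// EFinM muleA.
rewrite ge0_integralZl//; [|exact: pdfmE|by rewrite mule_ge0].
by rewrite integral_normal_pdf mule1.
Qed.

End gaussian.

Section sums_of_gaussian_statistics.
Context {d : measure_display} {T : measurableType d} {R : realType}.
Variables (F : T -> R) (s : R).
Hypotheses (mF : measurable_fun setT F) (s_gt0 : 0 < s).
Local Open Scope ereal_scope.

Definition gaussian_statistic {d'} {T' : measurableType d'} (P : probability T' R)
    (G : T' -> R) (m t : R) :=
  forall h : R -> \bar R, measurable_fun setT h -> (forall x, 0 <= h x) ->
  \int[P]_x h (G x) = \int[normal_prob m t]_y h y.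

(** The statistic F is arbitrary so that the lemma applies to the entries of a
row and then again to the rows of a matrix, whose statistic is their sum. *)
Lemma gaussian_statistic_sum (n : nat) (P : 'I_n.+1 -> probability T R)
    (m : 'I_n.+1 -> R) :
  (forall i, gaussian_statistic (P i) F (m i) s) ->
  gaussian_statistic (tuple_product P)
    (fun x => \sum_(i < n.+1) F (tnth x i))%R (\sum_(i < n.+1) m i)%R
    (Num.sqrt n.+1%:R * s)%R.
Proof.
have msum k : measurable_fun setT (fun x : k.-tuple T => \sum_(i < k) F (tnth x i))%R.
  exact: (@measurable_sum_tnth _ _ _ _ (fun=> F)).
elim: n P m => [|n IHn] P m gP h mh h0.
  rewrite integral_tuple_productS//; last first.
    exact: (measurableT_comp mh (msum _)).
  rewrite big_ord_recl big_ord0 addr0 sqrtr1 mul1r -gP//.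
  apply: eq_integral => x _; rewrite integral_tuple_product0//.
    by rewrite big_ord_recl big_ord0 addr0.
    apply: (measurableT_comp mh).
    apply: (measurableT_comp (msum _)).
    apply: (measurableT_comp (@measurable_tuple_cons _ T 0)).
    exact: pair1_measurable.
rewrite integral_tuple_productS//; last first.
  exact: (measurableT_comp mh (msum _)).
have mhx u : measurable_fun setT (fun y : R => h (u + y)%R).
  by apply: (measurableT_comp mh); exact: measurable_funD.
have stepE x :
    \int[tuple_product (fun i => P (lift ord0 i))]_t
      h (\sum_(i < n.+2) F (tnth (tuple_cons (x, t)) i))%R =
    \int[normal_prob (\sum_(i < n.+1) m (lift ord0 i))%R
      (Num.sqrt n.+1%:R * s)%R]_y h (F x + y)%R.
  rewrite -(IHn _ _ (fun i => gP (lift ord0 i)) _ (mhx (F x)) (fun y => h0 (F x + y)%R)).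
  apply: eq_integral => t _; rewrite big_ord_recl /=; congr (h (_ + _)%R).
  by apply: eq_bigr => i _; rewrite tnthS.
transitivity (\int[P ord0]_x \int[normal_prob (\sum_(i < n.+1) m (lift ord0 i))%R
      (Num.sqrt n.+1%:R * s)%R]_y h (F x + y)%R).
  by apply: eq_integral => x _; exact: stepE.
rewrite (gP ord0 _ (measurable_integral_add (normal_prob _ _) mh h0)); last first.
  by move=> u; apply: integral_ge0 => y _; exact: h0.
rewrite (normal_convolution _ _ s_gt0 _ mh h0); last first.
  by rewrite mulr_gt0// sqrtr_gt0.
have sdE : Num.sqrt (s ^+ 2 + (Num.sqrt n.+1%:R * s) ^+ 2)%R = (Num.sqrt n.+2%:R * s)%R.
  rewrite exprMn sqr_sqrtr// -{1}[(s ^+ 2)%R]mul1r -mulrDl -(natr1 n.+1) addrC.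
  by rewrite sqrtrM// sqrtr_sqr ger0_norm// ltW.
by rewrite sdE [in RHS]big_ord_recl.
Qed.

End sums_of_gaussian_statistics.

(** * The risk of the sum test *)

Section sum_test.
Context {R : realType}.
Notation mu := (@lebesgue_measure R).
Notation matrix_space N := (N.-tuple (N.-tuple (measurableTypeR R))).

(** The standard normal density at 2. *)
Definition gap_const : R := expR (- 2) / Num.sqrt (pi *+ 2).

Lemma gap_const_gt0 : 0 < gap_const.
Proof. by rewrite divr_gt0 ?expR_gt0// sqrtr_gt0 mulrn_wgt0// pi_gt0. Qed.

(** On the negative half-line the density with mean a is at most the centred one
times exp (a x / s^2), a factor at most 1, and at most exp (- a / s) once
x <= - s. The interval from - 2 s to - s is where a loss linear in a is
collected: there the centred density is at least gap_const / s. *)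
Lemma normal_pdf_gap (s a0 a x : R) : 0 < s -> 0 <= a0 <= a -> x <= 0 ->
  normal_pdf a s x +
    gap_const / s * (1 - expR (- (a0 / s))) * \1_(`[- (s *+ 2), - s]%classic) x
  <= normal_pdf 0 s x.
Proof.
move=> s0 /andP[a00 a0a] x0; rewrite !normal_pdfE ?gt_eqF// /normal_fun.
set pk := normal_peak s.
have pk0 : 0 < pk by rewrite normal_peak_gt0// gt_eqF.
have a_ge0 : 0 <= a by exact: le_trans a0a.
have s2 : 0 < s ^+ 2 *+ 2 by rewrite mulrn_wgt0// exprn_gt0.
have pdfa : expR (- (x - a) ^+ 2 / (s ^+ 2 *+ 2)) <=
    expR (a * x / s ^+ 2) * expR (- (x - 0) ^+ 2 / (s ^+ 2 *+ 2)).
  rewrite -expRD ler_expR subr0.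
  have -> : a * x / s ^+ 2 + - x ^+ 2 / (s ^+ 2 *+ 2) =
     (- x ^+ 2 + 2 * a * x) / (s ^+ 2 *+ 2) by field; rewrite gt_eqF.
  rewrite ler_pM2r ?invr_gt0//; nra.
set E0 := expR (- (x - 0) ^+ 2 / _) in pdfa *.
have E0_gt0 : 0 < E0 by exact: expR_gt0.
rewrite indicE; have [xs|] := boolP (x \in _); last first.
  move=> _; rewrite mulr0 addr0 ler_pM2l//; apply: (le_trans pdfa).
  rewrite ler_piMl// ?expR_ge0// expR_le1.
  rewrite -oppr_ge0 -mulNr divr_ge0 ?sqr_ge0// oppr_ge0.
  by rewrite mulr_ge0_le0.
move: xs; rewrite inE/= in_itv/= => /andP[x1 x2].
have E0_ge : expR (- 2) <= E0.
  rewrite ler_expR subr0 ler_pdivlMr// mulNr lerN2.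
  rewrite -(mulr_natr (s^+2)).
  nra.
have ea : expR (a * x / s ^+ 2) <= expR (- (a0 / s)).
  rewrite ler_expR.
  have -> : a * x / s ^+ 2 = (a * x / s) / s by field; rewrite gt_eqF.
  rewrite -mulNr ler_pM2r ?invr_gt0// ler_pdivrMr//.
  nra.
have -> : gap_const / s = pk * expR (- 2).
  rewrite /pk /normal_peak /gap_const -mulrnAr sqrtrM ?sqr_ge0// sqrtr_sqr gtr0_norm//.
  by field; rewrite !gt_eqF// sqrtr_gt0 mulrn_wgt0// pi_gt0.
rewrite mulr1 -!mulrA -mulrDr ler_pM2l//.
have e1 : 0 <= 1 - expR (- (a0 / s)).
  by rewrite subr_ge0 expR_le1 oppr_le0 divr_ge0// ltW.
apply: (@le_trans _ _ (expR (- (a0 / s)) * E0 + E0 * (1 - expR (- (a0 / s))))).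
  rewrite lerD//; last exact: ler_wpM2r.
  by apply: (le_trans pdfa); rewrite ler_pM2r.
by rewrite le_eqVlt; apply/orP; left; apply/eqP; ring.
Qed.

Lemma normal_prob_gap (s a0 a : R) : 0 < s -> 0 <= a0 <= a ->
  (normal_prob a s `]-oo, 0%R] + (gap_const * (1 - expR (- (a0 / s))))%:E
    <= normal_prob 0 s `]-oo, 0%R])%E.
Proof.
move=> s0 a0a; have /andP[a00 _] := a0a.
have e1 : 0 <= 1 - expR (- (a0 / s)).
  by rewrite subr_ge0 expR_le1 oppr_le0 divr_ge0// ltW.
have k0 : 0 <= gap_const / s * (1 - expR (- (a0 / s))).
  by rewrite mulr_ge0// divr_ge0 ?ltW// gap_const_gt0.
have mpdf m : measurable_fun (`]-oo, 0]%classic : set (measurableTypeR R)) (fun x : R => (normal_pdf m s x)%:E).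
  by apply: measurable_funTS; apply/measurable_EFinP; exact: measurable_normal_pdf.
set c := gap_const / s * _ in k0.
have <- : (\int[mu]_(x in `]-oo, 0%R]) (c%:E * (\1_(`[- (s *+ 2), - s]%classic) x)%:E) =
   (gap_const * (1 - expR (- (a0 / s))))%:E)%E.
  rewrite ge0_integralZl//; last first.
    by apply: measurable_funTS; apply/measurable_EFinP; exact: measurable_indic.
  rewrite integral_indic// setIidl; last first.
    move=> x /=; rewrite !in_itv/= => /andP[_ xs].
    by rewrite (le_trans xs)// oppr_le0 ltW.
  rewrite /= lebesgue_measure_itv/= lte_fin ltrN2 mulr2n ltrDl s0 -EFinD -EFinM.
  congr EFin; rewrite /c; field; by rewrite gt_eqF.
rewrite -ge0_integralD//=; last 3 first.
- by move=> x _; rewrite lee_fin normal_pdf_ge0.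
- by move=> x _; rewrite mule_ge0// lee_fin.
- apply: emeasurable_funM => //.
  by apply: measurable_funTS; apply/measurable_EFinP; exact: measurable_indic.
apply: ge0_le_integral => //.
- by move=> x _; rewrite adde_ge0 ?mule_ge0 ?lee_fin ?normal_pdf_ge0.
- apply: emeasurable_funD => //; apply: emeasurable_funM => //.
  by apply: measurable_funTS; apply/measurable_EFinP; exact: measurable_indic.
- move=> x /=; rewrite in_itv/= => x0.
  by rewrite -EFinM -EFinD lee_fin normal_pdf_gap.
Qed.

End sum_test.

Section sum_test_risk.
Context {R : realType}.
Notation matrix_space N := (N.-tuple (N.-tuple (measurableTypeR R))).

Lemma gaussian_statistic_preimage {d} {T : measurableType d}
    (P : probability T R) (G : T -> R) (m s : R) (B : set (measurableTypeR R)) :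
  measurable_fun setT G -> gaussian_statistic P G m s -> measurable B ->
  P (G @^-1` B) = normal_prob m s B.
Proof.
move=> mG gG mB.
have mGB : measurable (G @^-1` B) by rewrite -[X in measurable X]setTI; exact: mG.
have mB1 : measurable_fun setT (fun x : measurableTypeR R => (\1_B x)%:E : \bar R).
  by apply/measurable_EFinP; exact: measurable_indic.
have B0 x : (0 <= (\1_B x)%:E :> \bar R)%E by rewrite lee_fin.
have := gG _ mB1 B0.
rewrite [RHS]integral_indic// setIT => <-.
rewrite -[in LHS](setIT (G @^-1` B)).
exact/esym/(integral_indic P measurableT mGB).
Qed.

Definition entry_sum {N : nat} (X : matrix_space N) : R :=
  \sum_(i < N) \sum_(j < N) tnth (tnth X i) j.

Lemma measurable_row_sum N : measurable_fun setT
  (fun x : N.-tuple (measurableTypeR R) => \sum_(j < N) (tnth x j : R)).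
Proof. exact: (@measurable_sum_tnth _ (measurableTypeR R) R _ (fun=> id)). Qed.

Lemma measurable_entry_sum N : measurable_fun setT (@entry_sum N).
Proof.
exact: (@measurable_sum_tnth _ _ R N (fun _ x => \sum_(j < N) (tnth x j : R))
  (fun=> @measurable_row_sum N)).
Qed.

Lemma gaussian_entry_sum (N : nat) (theta : 'M[R]_N.+1) :
  gaussian_statistic (gaussian_matrix_law theta) entry_sum
    (\sum_(i < N.+1) \sum_(j < N.+1) theta i j) N.+1%:R.
Proof.
have rowP i : gaussian_statistic (tuple_product (fun j => normal_prob (theta i j) 1))
    (fun x : N.+1.-tuple (measurableTypeR R) => \sum_(j < N.+1) (tnth x j : R))
    (\sum_(j < N.+1) theta i j) (Num.sqrt N.+1%:R * 1).
  by apply: (@gaussian_statistic_sum _ (measurableTypeR R) R id) => // j h mh h0.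
have := gaussian_statistic_sum _ _ rowP.
rewrite mulr1 -expr2 sqr_sqrtr//; apply.
- exact: measurable_row_sum.
- by rewrite sqrtr_gt0.
Qed.

Definition sum_positive {N : nat} (X : matrix_space N) : bool := 0 < entry_sum X.

Lemma measurable_sum_positive N : measurable_fun setT (@sum_positive N).
Proof. by apply: measurable_fun_ltr => //; exact: measurable_entry_sum. Qed.

HB.instance Definition _ N :=
  isMeasurableFun.Build _ _ _ _ (@sum_positive N) (@measurable_sum_positive N).

Lemma sum_positive_false (N : nat) (theta : 'M[R]_N.+1) :
  gaussian_matrix_law theta [set X | sum_positive X = false] =
  normal_prob (\sum_(i < N.+1) \sum_(j < N.+1) theta i j) N.+1%:R `]-oo, 0%R].
Proof.
rewrite -(gaussian_statistic_preimage (@measurable_entry_sum N.+1) (gaussian_entry_sum theta))//.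
congr (gaussian_matrix_law theta _); apply/seteqP; split => X /=.
- by rewrite /sum_positive in_itv/= leNgt => ->.
- by rewrite /sum_positive in_itv/= leNgt => /negbTE.
Qed.

(** The entries outside of the submatrix vanish, so they cannot lower the sum. *)
Lemma Theta_sum_ge (A : R) (n N : nat) (theta : 'M[R]_N) : Theta A n theta ->
  A * n%:R ^+ 2 <= \sum_(i < N) \sum_(j < N) theta i j.
Proof.
move=> [Rw [Cl [cR cC thA th0]]].
have -> : A * n%:R ^+ 2 = \sum_(i in Rw) \sum_(j in Cl) A.
  by rewrite !sumr_const cR cC -[RHS]mulr_natr -(mulr_natr A) expr2 mulrA.
rewrite [leRHS](bigID (mem Rw))/= -[leLHS]addr0 lerD//.
- apply: ler_sum => i iR; rewrite [leRHS](bigID (mem Cl))/= -[leLHS]addr0 lerD//.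
    by apply: ler_sum => j jC; exact: thA.
  by rewrite sumr_ge0// => j jC; rewrite th0// (negbTE jC) andbF.
- rewrite sumr_ge0// => i iR; rewrite sumr_ge0// => j _.
  by rewrite th0// (negbTE iR).
Qed.

(** The null error of the sum test is 1 - p and its worst alternative error at
most p - c, where p is the mass of the centred normal law on the negative
half-line. *)
Lemma minimax_risk_le_sum_test (A : R) (n N : nat) : 0 <= A -> (0 < N)%N ->
  (minimax_risk A n N <=
    (1 - gap_const * (1 - expR (- (A * n%:R ^+ 2 / N%:R))))%:E)%E.
Proof.
move=> A0; case: N => // N _.
apply: ge_ereal_inf.
exists (test_risk A n (@sum_positive N.+1 : {mfun _ >-> _})); first by exists sum_positive.
set c := gap_const * _.
have [p pE] : exists p : R, normal_prob (0 : R) N.+1%:R `]-oo, (0 : R)] = p%:E.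
  by exists (fine (normal_prob (0 : R) N.+1%:R `]-oo, (0 : R)])); rewrite fineK// fin_num_measure.
have H0 : gaussian_matrix_law (0 : 'M[R]_N.+1) [set X | sum_positive X = true] =
    (1 - p)%:E.
  have -> : [set X : matrix_space N.+1 | sum_positive X = true] =
      ~` [set X | sum_positive X = false].
    by apply/seteqP; split => X /=; case: sum_positive.
  rewrite probability_setC; last first.
    rewrite -[X in measurable X]setTI.
    exact: (@measurable_sum_positive N.+1 measurableT [set false]).
  rewrite sum_positive_false big1 ?pE// => i _; rewrite big1// => j _.
  by rewrite mxE.
have Hs : (ereal_sup [set gaussian_matrix_law theta [set X | sum_positive X = false]
            | theta in @Theta R A n N.+1] <= (p - c)%:E)%E.
  apply: ge_ereal_sup => _ [theta Th <-].
  rewrite sum_positive_false EFinB leeBrDr// -pE.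
  apply: normal_prob_gap; first by rewrite ltr0n.
  apply/andP; split; first by rewrite mulr_ge0 ?sqr_ge0.
  exact: Theta_sum_ge.
have HH : ((1 - p)%:E + (p - c)%:E = (1 - c)%:E :> \bar R)%E.
  by rewrite -EFinD addrA subrK.
rewrite -HH -H0.
exact: (leeD2l _ Hs).
Qed.

End sum_test_risk.

(** * Likelihood ratios of Gaussian matrices *)

Section likelihood_ratio.
Context {R : realType}.
Notation matrix_space N := (N.-tuple (N.-tuple (measurableTypeR R))).

Definition log_lr {N : nat} (theta : 'M[R]_N) (X : matrix_space N) : R :=
  \sum_(i < N) \sum_(j < N) (theta i j * tnth (tnth X i) j - theta i j ^+ 2 / 2).

Lemma measurable_row_log_lr N (v : 'I_N -> R) : measurable_fun setT
  (fun x : N.-tuple (measurableTypeR R) =>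
     \sum_(j < N) (v j * (tnth x j : R) - v j ^+ 2 / 2)).
Proof.
apply: (@measurable_sum_tnth _ (measurableTypeR R) R N
  (fun j x => v j * (x : R) - v j ^+ 2 / 2)) => j.
by apply: measurable_funB => //; exact: measurable_funM.
Qed.

Lemma measurable_log_lr N (theta : 'M[R]_N) : measurable_fun setT (log_lr theta).
Proof.
exact: (@measurable_sum_tnth _ _ R N
  (fun i x => \sum_(j < N) (theta i j * (tnth x j : R) - theta i j ^+ 2 / 2))
  (fun i => @measurable_row_log_lr N (theta i))).
Qed.

Lemma normal_pdf_mean_shift (m x : R) :
  normal_pdf m 1 x = normal_pdf 0 1 x * expR (m * x - m ^+ 2 / 2).
Proof.
rewrite !normal_pdfE ?oner_neq0// /normal_fun -mulrA -expRD.
congr (_ * expR _); rewrite subr0 expr1n; by field.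
Qed.

Lemma normal_prob_lr (m : R) :
  has_density (normal_prob 0 1) (normal_prob m 1)
    (fun x : measurableTypeR R => expR (m * x - m ^+ 2 / 2)).
Proof.
move=> h mh h0.
have mlr : measurable_fun setT (fun x : measurableTypeR R => expR (m * x - m ^+ 2 / 2)).
  apply: measurableT_comp; first exact: measurable_expR.
  by apply: measurable_funB => //; exact: measurable_funM.
rewrite (integral_normal_prob m 1 mh h0).
rewrite (@integral_normal_prob R 0 1 (fun x => h x * (expR (m * x - m ^+ 2 / 2))%:E)%E).
- apply: eq_integral => x _.
  by rewrite normal_pdf_mean_shift EFinM -muleA (muleC (normal_pdf 0 1 x)%:E).
- by apply: emeasurable_funM => //; exact/measurable_EFinP.
- by move=> x; rewrite mule_ge0// lee_fin expR_ge0.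
Qed.

Lemma gaussian_matrix_lr N (theta : 'M[R]_N) :
  has_density (gaussian_matrix_law (0 : 'M[R]_N)) (gaussian_matrix_law theta)
    (fun X => expR (log_lr theta X)).
Proof.
have mlr (m : R) : measurable_fun setT
    (fun x : measurableTypeR R => expR (m * x - m ^+ 2 / 2)).
  apply: measurableT_comp; first exact: measurable_expR.
  by apply: measurable_funB => //; exact: measurable_funM.
pose g i (x : N.-tuple (measurableTypeR R)) :=
  expR (\sum_(j < N) (theta i j * (tnth x j : R) - theta i j ^+ 2 / 2)).
have -> : (fun X => expR (log_lr theta X)) =
    (fun X : matrix_space N => \prod_(i < N) g i (tnth X i)).
  by apply/funext => X; rewrite /log_lr expR_sum.
apply: has_density_tuple_product.
- move=> i; apply: measurableT_comp; first exact: measurable_expR.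
  exact: measurable_row_log_lr.
- by move=> i x; exact: expR_ge0.
- move=> i; rewrite /gaussian_matrix_law.
  have -> : g i = (fun x : N.-tuple (measurableTypeR R) => \prod_(j < N)
      expR (theta i j * tnth x j - theta i j ^+ 2 / 2)).
    by apply/funext => x; rewrite /g expR_sum.
  apply: (@has_density_tuple_product _ (measurableTypeR R) R N _ _
    (fun j y => expR (theta i j * (y : R) - theta i j ^+ 2 / 2))).
  + by move=> j; exact: mlr.
  + by move=> j y; exact: expR_ge0.
  + by move=> j; rewrite mxE; exact: normal_prob_lr.
Qed.

End likelihood_ratio.

(** * Lower bound on the risk by a truncated second moment *)

Section truncated_second_moment.
Context {d : measure_display} {T : measurableType d} {R : realType}.
Variables (P : probability T R) (I : finType) (Q : I -> probability T R).
Variables (g : I -> T -> R) (D : I -> set T) (b : I -> I -> R) (eta chi : R).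
Hypotheses (I_gt0 : (0 < #|I|)%N)
  (mg : forall i, measurable_fun setT (g i)) (g0 : forall i x, 0 <= g i x)
  (dQ : forall i, has_density P (Q i) (g i))
  (mD : forall i, measurable (D i))
  (QD : forall i, ((1 - eta)%:E <= Q i (D i))%E)
  (Eb : forall i j,
    (\int[P]_x (g i x * \1_(D i) x * (g j x * \1_(D j) x))%:E <= (b i j)%:E)%E)
  (sum_b : \sum_i \sum_j b i j <= #|I|%:R ^+ 2 * (1 + chi)).

(* L is the mixture of truncated likelihood ratios; it never exceeds the
   density of the uniform mixture of the Q i. *)
Let M : R := #|I|%:R.
Let u i x := g i x * \1_(D i) x.
Let L x := M^-1 * \sum_i u i x.

Let M0 : 0 < M. Proof. by rewrite ltr0n. Qed.

Let mu_ i : measurable_fun setT (u i).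
Proof. by apply: measurable_funM => //; exact: measurable_indic. Qed.

Let u0 i x : 0 <= u i x.
Proof. by rewrite mulr_ge0. Qed.

Let mL : measurable_fun setT L.
Proof. by apply: measurable_funM => //; exact: measurable_sum. Qed.

Let L0 x : 0 <= L x.
Proof. by rewrite mulr_ge0 ?invr_ge0 ?(ltW M0)// sumr_ge0. Qed.

Let integral_avg (f : I -> T -> R) :
  (forall i, measurable_fun setT (f i)) -> (forall i x, 0 <= f i x) ->
  (\int[P]_x (\sum_i f i x)%:E = \sum_i \int[P]_x (f i x)%:E)%E.
Proof.
move=> mf f0; under eq_integral do rewrite -sumEFin.
rewrite ge0_integral_sum//.
- by move=> i; apply/measurable_EFinP.
- by move=> i x _; rewrite lee_fin.
Qed.

Let integralZ (k : R) (f : T -> R) : measurable_fun setT f -> (forall x, 0 <= f x) ->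
  0 <= k -> (\int[P]_x (k * f x)%:E = k%:E * \int[P]_x (f x)%:E)%E.
Proof.
move=> mf f0 k0; under eq_integral do rewrite EFinM.
rewrite ge0_integralZl//; first exact/measurable_EFinP.
by move=> x _; rewrite lee_fin.
Qed.

Let integral_density i B : measurable B ->
  (\int[P]_x (g i x * \1_B x)%:E = Q i B)%E.
Proof.
move=> mB; have mB1 : measurable_fun setT (fun x => (\1_B x)%:E : \bar R).
  by apply/measurable_EFinP; exact: measurable_indic.
rewrite -[in RHS](setIT B) -integral_indic// (dQ i mB1); last first.
  by move=> x; rewrite lee_fin.
by apply: eq_integral => x _; rewrite -EFinM mulrC.
Qed.

Let integral_L : ((1 - eta)%:E <= \int[P]_x (L x)%:E)%E.
Proof.
rewrite integralZ ?invr_ge0 ?(ltW M0)//; last 2 first.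
- exact: measurable_sum.
- by move=> x; exact: sumr_ge0.
rewrite integral_avg//.
under eq_bigr do rewrite integral_density//.
apply: (@le_trans _ _ (M^-1%:E * \sum_(i : I) (1 - eta)%:E)%E).
  rewrite sumEFin sumr_const -EFinM lee_fin -[(1 - eta) *+ _]mulr_natl mulrA.
  by rewrite mulVf ?mul1r// gt_eqF.
rewrite lee_wpmul2l ?lee_fin ?invr_ge0 ?(ltW M0)//.
by apply: lee_sum => i _; exact: QD.
Qed.

Let integral_LB B : measurable B ->
  (\int[P]_x (\1_B x * L x)%:E <= M^-1%:E * \sum_i Q i B)%E.
Proof.
move=> mB.
have mB1 : measurable_fun setT (\1_B : T -> R) by exact: measurable_indic.
apply: (@le_trans _ _ (\int[P]_x (M^-1 * \sum_i g i x * \1_B x)%:E)%E).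
  apply: ge0_le_integral => //.
  - by move=> x _; rewrite lee_fin mulr_ge0.
  - by apply/measurable_EFinP; exact: measurable_funM.
  - apply/measurable_EFinP; apply: measurable_funM => //.
    by apply: measurable_sum => i; exact: measurable_funM.
  - move=> x _; rewrite lee_fin mulrCA ler_wpM2l ?invr_ge0 ?(ltW M0)//.
    rewrite mulr_sumr ler_sum// => i _.
    rewrite mulrC ler_wpM2r// /u ler_piMr//.
rewrite integralZ ?invr_ge0 ?(ltW M0)//; last 2 first.
- by apply: measurable_sum => i; exact: measurable_funM.
- by move=> x; apply: sumr_ge0 => i _; rewrite mulr_ge0.
rewrite integral_avg.
- by under eq_bigr do rewrite integral_density//.
- by move=> i; exact: measurable_funM.
- by move=> i x; rewrite mulr_ge0.
Qed.

Let integral_L2 : (\int[P]_x (L x ^+ 2)%:E <= (1 + chi)%:E)%E.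
Proof.
have LE x : L x ^+ 2 = (M ^+ 2)^-1 * \sum_i \sum_j u i x * u j x.
  rewrite /L exprMn exprVn; congr (_ * _).
  by rewrite expr2 big_distrlr.
under eq_integral do rewrite LE.
have muu i j : measurable_fun setT (fun x => u i x * u j x) by exact: measurable_funM.
rewrite integralZ ?invr_ge0 ?sqr_ge0//; last 2 first.
- by apply: measurable_sum => i; exact: measurable_sum.
- by move=> x; apply: sumr_ge0 => i _; apply: sumr_ge0 => j _; rewrite mulr_ge0.
rewrite integral_avg; last 2 first.
- by move=> i; exact: measurable_sum.
- by move=> i x; apply: sumr_ge0 => j _; rewrite mulr_ge0.
apply: (@le_trans _ _ ((M ^+ 2)^-1%:E * (\sum_i \sum_j b i j)%:E)%E).
  rewrite lee_wpmul2l ?lee_fin ?invr_ge0 ?sqr_ge0//.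
  rewrite -sumEFin; apply: lee_sum => i _.
  rewrite integral_avg//; last by move=> j x; rewrite mulr_ge0.
  by rewrite -sumEFin; apply: lee_sum => j _; exact: Eb.
rewrite -EFinM lee_fin mulrC ler_pdivrMr ?exprn_gt0//.
by rewrite [leRHS]mulrC.
Qed.

(** Integrates the pointwise inequality
1_B (1 - L) <= s / 2 + (1 - L)^2 / (2 s), written with nonnegative terms only on
either side so that integrals may be split. The parameter s plays the part of
the square root in the Cauchy-Schwarz inequality. *)
Lemma mixture_lower_bound (s : R) (B : set T) : 0 < s -> measurable B ->
  (P B <= M^-1%:E * \sum_i Q i B + (s / 2 + (chi + 2 * eta) / (2 * s))%:E)%E.
Proof.
move=> s0 mB.
have mB1 : measurable_fun setT (\1_B : T -> R) by exact: measurable_indic.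
have pointwise x : \1_B x + s^-1 * L x <=
    \1_B x * L x + (s / 2 + (2 * s)^-1 * (1 + L x ^+ 2)).
  set l := L x; have l0 : 0 <= l by exact: L0.
  have AG y : y <= s / 2 + (2 * s)^-1 * y ^+ 2.
    rewrite -subr_ge0.
    have -> : s / 2 + (2 * s)^-1 * y ^+ 2 - y = (y - s) ^+ 2 / (2 * s).
      by field; rewrite gt_eqF.
    by rewrite divr_ge0 ?sqr_ge0// mulr_ge0// ltW.
  have E : (2 * s)^-1 * (1 + l ^+ 2) = (2 * s)^-1 * (1 - l) ^+ 2 + s^-1 * l.
    by field; rewrite gt_eqF.
  rewrite E indicE; case: (x \in B); have := AG (1 - l); rewrite ?mulr1n ?mulr0n; first by rewrite !mul1r; lra.
  rewrite !mul0r; have : 0 <= (2 * s)^-1 * (1 - l) ^+ 2.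
    by rewrite mulr_ge0 ?sqr_ge0// invr_ge0 mulr_ge0// ltW.
  have : 0 < s / 2 by rewrite divr_gt0.
  lra.
have s10 : 0 <= s^-1 by rewrite invr_ge0 ltW.
have s20 : 0 <= (2 * s)^-1 by rewrite invr_ge0 mulr_ge0// ltW.
have mL2 : measurable_fun setT (fun x => L x ^+ 2) by exact: measurable_funX.
have int_pointwise :
  (\int[P]_x (\1_B x + s^-1 * L x)%:E <=
   \int[P]_x (\1_B x * L x + (s / 2 + (2 * s)^-1 * (1 + L x ^+ 2)))%:E)%E.
  apply: ge0_le_integral => //.
  - by move=> x _; rewrite lee_fin addr_ge0// mulr_ge0.
  - apply/measurable_EFinP; apply: measurable_funD => //.
    exact: measurable_funM.
  - apply/measurable_EFinP; apply: measurable_funD; first exact: measurable_funM.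
    apply: measurable_funD => //; apply: measurable_funM => //.
    exact: measurable_funD.
  - by move=> x _; rewrite lee_fin.
have addI (f1 f2 : T -> R) : measurable_fun setT f1 -> measurable_fun setT f2 ->
    (forall x, 0 <= f1 x) -> (forall x, 0 <= f2 x) ->
    (\int[P]_x (f1 x + f2 x)%:E = \int[P]_x (f1 x)%:E + \int[P]_x (f2 x)%:E)%E.
  move=> m1 m2 f10 f20; under eq_integral do rewrite EFinD.
  by rewrite ge0_integralD//; [move=> x _; rewrite lee_fin|exact/measurable_EFinP
    |move=> x _; rewrite lee_fin|exact/measurable_EFinP].
have cstI (k : R) : (\int[P]_x k%:E = k%:E)%E.
  by rewrite integral_cst//= probability_setT mule1.
have lhsE : (\int[P]_x (\1_B x + s^-1 * L x)%:E =
    P B + s^-1%:E * \int[P]_x (L x)%:E)%E.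
  rewrite addI//; last 2 first.
  - exact: measurable_funM.
  - by move=> x; rewrite mulr_ge0.
  by rewrite integral_indic// setIT integralZ.
have rhsE : (\int[P]_x (\1_B x * L x + (s / 2 + (2 * s)^-1 * (1 + L x ^+ 2)))%:E =
    \int[P]_x (\1_B x * L x)%:E +
    ((s / 2)%:E + (2 * s)^-1%:E * (1 + \int[P]_x (L x ^+ 2)%:E)))%E.
  have m3 : measurable_fun setT (fun x => 1 + L x ^+ 2) by exact: measurable_funD.
  have m4 : measurable_fun setT (fun x => (2 * s)^-1 * (1 + L x ^+ 2)).
    exact: measurable_funM.
  have p3 x : 0 <= 1 + L x ^+ 2 by rewrite addr_ge0// sqr_ge0.
  have sh : 0 <= s / 2 by rewrite divr_ge0// ltW.
  rewrite addI; last 4 first.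
  - exact: measurable_funM.
  - exact: measurable_funD.
  - by move=> x; rewrite mulr_ge0.
  - by move=> x; rewrite addr_ge0// mulr_ge0.
  rewrite addI//; last by move=> x; rewrite mulr_ge0.
  rewrite cstI integralZ// addI//; last by move=> x; rewrite sqr_ge0.
  by rewrite cstI.
rewrite lhsE rhsE in int_pointwise.
have H1 : (P B + (s^-1 * (1 - eta))%:E <= M^-1%:E * \sum_i Q i B +
    (s / 2 + (2 * s)^-1 * (1 + (1 + chi)))%:E)%E.
  apply: (@le_trans _ _ (P B + s^-1%:E * \int[P]_x (L x)%:E)%E).
    by rewrite leeD2l// EFinM lee_wpmul2l// ?lee_fin.
  apply: (le_trans int_pointwise); apply: leeD; first exact: integral_LB.
  rewrite EFinD leeD2l// EFinM lee_wpmul2l ?lee_fin//.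
  by rewrite EFinD leeD2l.
have PBfin : P B \is a fin_num by exact: fin_num_measure.
have -> : s / 2 + (chi + 2 * eta) / (2 * s) =
    s / 2 + (2 * s)^-1 * (1 + (1 + chi)) - s^-1 * (1 - eta).
  by field; rewrite gt_eqF.
by rewrite [X in (_ + X)%E]EFinB addeA leeBrDr.
Qed.

End truncated_second_moment.

Lemma integral_probability_cst {d} {T : measurableType d} {R : realType}
    (P : probability T R) (r : R) : (\int[P]_x r%:E = r%:E)%E.
Proof. by rewrite integral_cst//= probability_setT mule1. Qed.

(** * Moments of truncated Gaussian likelihood ratios *)

Section gaussian_mixture.
Context {R : realType} {N : nat}.
Notation matrix_space N := (N.-tuple (N.-tuple (measurableTypeR R))).
Implicit Types theta : 'M[R]_N.
Notation P0 := (gaussian_matrix_law (0 : 'M[R]_N)).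

Definition mxdot (theta theta' : 'M[R]_N) : R := \sum_i \sum_j theta i j * theta' i j.

Definition linear_stat theta (X : matrix_space N) : R :=
  \sum_(i < N) \sum_(j < N) theta i j * tnth (tnth X i) j.

Lemma log_lrE theta X : log_lr theta X = linear_stat theta X - mxdot theta theta / 2.
Proof.
rewrite /log_lr /linear_stat /mxdot mulr_suml -sumrB; apply: eq_bigr => i _.
by rewrite mulr_suml -sumrB; apply: eq_bigr => j _; rewrite expr2.
Qed.

Lemma linear_statD theta theta' X :
  linear_stat (theta + theta') X = linear_stat theta X + linear_stat theta' X.
Proof.
rewrite /linear_stat -big_split; apply: eq_bigr => i _ /=.
by rewrite -big_split; apply: eq_bigr => j _; rewrite mxE mulrDl.
Qed.

Lemma linear_statZ c theta X : linear_stat (c *: theta) X = c * linear_stat theta X.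
Proof.
rewrite /linear_stat mulr_sumr; apply: eq_bigr => i _.
by rewrite mulr_sumr; apply: eq_bigr => j _; rewrite mxE mulrA.
Qed.

Lemma mxdotZZ c theta : mxdot (c *: theta) (c *: theta) = c ^+ 2 * mxdot theta theta.
Proof.
rewrite /mxdot mulr_sumr; apply: eq_bigr => i _.
by rewrite mulr_sumr; apply: eq_bigr => j _; rewrite mxE; ring.
Qed.

Lemma mxdotDD theta theta' : mxdot (theta + theta') (theta + theta') =
  mxdot theta theta + 2 * mxdot theta theta' + mxdot theta' theta'.
Proof.
rewrite /mxdot mulr_sumr -!big_split; apply: eq_bigr => i _ /=.
by rewrite mulr_sumr -!big_split; apply: eq_bigr => j _ /=; rewrite mxE; ring.
Qed.

Lemma measurable_linear_stat theta : measurable_fun setT (linear_stat theta).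
Proof.
rewrite (_ : linear_stat theta = (fun X => log_lr theta X + mxdot theta theta / 2)).
  by apply: measurable_funD => //; exact: measurable_log_lr.
by apply/funext => X; rewrite log_lrE subrK.
Qed.

Lemma measurable_exp_linear_stat theta c :
  measurable_fun setT (fun X => expR (linear_stat theta X + c)).
Proof.
apply: measurableT_comp; first exact: measurable_expR.
by apply: measurable_funD => //; exact: measurable_linear_stat.
Qed.

Lemma integral_gaussian_matrix theta (h : matrix_space N -> \bar R) :
  measurable_fun setT h -> (forall X, 0 <= h X)%E ->
  (\int[gaussian_matrix_law theta]_X h X =
   \int[P0]_X (h X * (expR (log_lr theta X))%:E))%E.
Proof. exact: gaussian_matrix_lr. Qed.

(** The likelihood ratio integrates to 1: this is the Gaussian moment generating
function without any computation of integrals. *)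
Lemma integral_exp_linear_stat theta c :
  (\int[P0]_X (expR (linear_stat theta X + c))%:E =
   (expR (mxdot theta theta / 2 + c))%:E)%E.
Proof.
have m1 : measurable_fun setT
    (fun _ : matrix_space N => (expR (mxdot theta theta / 2 + c))%:E : \bar R).
  exact: measurable_cst.
have p1 (X : matrix_space N) : (0 <= (expR (mxdot theta theta / 2 + c))%:E :> \bar R)%E.
  by rewrite lee_fin expR_ge0.
have E1 := integral_gaussian_matrix theta m1 p1.
have E2 : (\int[P0]_X (expR (linear_stat theta X + c))%:E =
    \int[P0]_X ((expR (mxdot theta theta / 2 + c))%:E * (expR (log_lr theta X))%:E))%E.
  apply: eq_integral => X _; rewrite -EFinM -expRD log_lrE; congr (expR _)%:E.
  by ring.
have E3 : (\int[gaussian_matrix_law theta]_X (expR (mxdot theta theta / 2 + c))%:E =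
    (expR (mxdot theta theta / 2 + c))%:E)%E by exact: integral_probability_cst.
by rewrite E2 -E1 E3.
Qed.

Definition truncation theta (h : R) : set (matrix_space N) :=
  [set X | linear_stat theta X <= h].

Lemma measurable_truncation theta h : measurable (truncation theta h).
Proof.
rewrite -[X in measurable X]setTI.
have mle : measurable_fun setT (fun X => linear_stat theta X <= h).
  by apply: measurable_fun_ler => //; exact: measurable_linear_stat.
exact: (mle measurableT [set true]).
Qed.

(** Chernoff on the truncation: the indicator of linear_stat <= h is at most
exp (t (h - linear_stat)), which shrinks both signals by the factor 1 - t. *)
Lemma integral_truncated_lr_pair theta theta' (q v h t : R) : 0 <= t ->
  mxdot theta theta = q -> mxdot theta' theta' = q -> mxdot theta theta' = v ->
  (\int[P0]_X (expR (log_lr theta X) * \1_(truncation theta h) X *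
     (expR (log_lr theta' X) * \1_(truncation theta' h) X))%:E <=
   (expR ((1 - t) ^+ 2 * (q + v) - q + 2 * t * h))%:E)%E.
Proof.
move=> t0 qE q'E vE.
have m1 th : measurable_fun setT
    (fun X => expR (log_lr th X) * \1_(truncation th h) X).
  apply: measurable_funM.
    by apply: measurableT_comp; [exact: measurable_expR|exact: measurable_log_lr].
  by apply: measurable_indic; exact: measurable_truncation.
have bound th X : expR (log_lr th X) * \1_(truncation th h) X <=
    expR ((1 - t) * linear_stat th X - mxdot th th / 2 + t * h).
  rewrite indicE; case: (boolP (X \in _)) => [|_]; last by rewrite mulr0 expR_ge0.
  rewrite inE /truncation /= mulr1 ler_expR log_lrE => Xh.
  have : 0 <= t * (h - linear_stat th X) by rewrite mulr_ge0// subr_ge0.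
  lra.
have -> : (1 - t) ^+ 2 * (q + v) - q + 2 * t * h =
    mxdot ((1 - t) *: (theta + theta')) ((1 - t) *: (theta + theta')) / 2
    + (2 * t * h - q).
  by rewrite mxdotZZ mxdotDD qE q'E vE; field.
rewrite -integral_exp_linear_stat.
apply: ge0_le_integral => //.
- by apply/measurable_EFinP; exact: measurable_funM.
- by apply/measurable_EFinP; exact: measurable_exp_linear_stat.
- move=> X _; rewrite lee_fin.
  apply: (le_trans (ler_pM _ _ (bound theta X) (bound theta' X))).
  + by rewrite mulr_ge0 ?expR_ge0.
  + by rewrite mulr_ge0 ?expR_ge0.
  rewrite -expRD ler_expR linear_statZ linear_statD qE q'E.
  by rewrite le_eqVlt; apply/orP; left; apply/eqP; field.
Qed.

(** Under its own signal the linear statistic has mean and variance q; this is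
the Chernoff bound for exceeding the mean by e q. *)
Lemma truncation_prob theta (q e : R) : 0 <= e -> mxdot theta theta = q ->
  ((1 - expR (- (e ^+ 2 * q / 2)))%:E <=
    gaussian_matrix_law theta (truncation theta ((1 + e) * q)))%E.
Proof.
move=> e0 qE; set h := (1 + e) * q.
have mD := measurable_truncation theta h.
have mD1 : measurable_fun setT (fun X => (\1_(~` truncation theta h) X)%:E : \bar R).
  by apply/measurable_EFinP; apply: measurable_indic; exact: measurableC.
have D10 (X : matrix_space N) : (0 <= (\1_(~` truncation theta h) X)%:E :> \bar R)%E.
  by rewrite lee_fin.
suff : (gaussian_matrix_law theta (~` truncation theta h) <=
    (expR (- (e ^+ 2 * q / 2)))%:E)%E.
  rewrite probability_setC//.
  have : gaussian_matrix_law theta (truncation theta h) \is a fin_num.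
    exact: fin_num_measure.
  case: (gaussian_matrix_law theta _) => // r _.
  by rewrite -EFinB !lee_fin; lra.
rewrite -(setIT (~` _)) -integral_indic//; last exact: measurableC.
rewrite (integral_gaussian_matrix theta mD1 D10).
have -> : - (e ^+ 2 * q / 2) = mxdot ((1 + e) *: theta) ((1 + e) *: theta) / 2
   + (- (q / 2) - e * h).
  by rewrite mxdotZZ qE /h; field.
rewrite -integral_exp_linear_stat.
apply: ge0_le_integral => //.
- apply: emeasurable_funM => //; apply/measurable_EFinP.
  by apply: measurableT_comp; [exact: measurable_expR|exact: measurable_log_lr].
- by apply/measurable_EFinP; exact: measurable_exp_linear_stat.
- move=> X _; rewrite -EFinM lee_fin indicE; case: (boolP (X \in _)) => [|_]; last first.
    by rewrite mul0r expR_ge0.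
  rewrite inE /truncation /= mul1r ler_expR log_lrE linear_statZ qE => /negP.
  rewrite -ltNge => Xh.
  have : 0 <= e * (linear_stat theta X - h) by rewrite mulr_ge0// subr_ge0 ltW.
  lra.
Qed.

End gaussian_mixture.

Section bayes_bound.
Context {R : realType} {N : nat}.
Notation matrix_space N := (N.-tuple (N.-tuple (measurableTypeR R))).
Notation P0 := (gaussian_matrix_law (0 : 'M[R]_N)).

(** q is the squared norm of the signals and v their scalar product. The first
bound is the exact moment without truncation, better when v is small against
q; the second is what the truncation gains. *)
Definition pair_moment (q e v : R) : R :=
  Num.min (expR v) (expR ((1 + 2 * e) * (q * v / (q + v)))).

(** The two bounds come from integral_truncated_lr_pair at t = 0 and at
t = v / (q + v), where (1 - t) (q + v) = q; this t is optimal at e = 0. *)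
Lemma truncated_pair_moment (theta theta' : 'M[R]_N) (q e v : R) :
  0 < q -> 0 <= v ->
  mxdot theta theta = q -> mxdot theta' theta' = q -> mxdot theta theta' = v ->
  (\int[P0]_X (expR (log_lr theta X) * \1_(truncation theta ((1 + e) * q)) X *
     (expR (log_lr theta' X) * \1_(truncation theta' ((1 + e) * q)) X))%:E <=
   (pair_moment q e v)%:E)%E.
Proof.
move=> q0 v0 qE q'E vE.
have bound t : 0 <= t -> _ := fun t0 =>
  integral_truncated_lr_pair ((1 + e) * q) t0 qE q'E vE.
rewrite /pair_moment; have [_|_] := leP (expR v) _.
  apply: (le_trans (bound 0 _)) => //.
  by rewrite lee_fin ler_expR; lra.
have qv0 : 0 < q + v by rewrite ltr_wpDr.
apply: (le_trans (bound (v / (q + v)) _)); first by rewrite divr_ge0// ltW.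
rewrite lee_fin ler_expR le_eqVlt; apply/orP; left; apply/eqP.
by field; rewrite gt_eqF.
Qed.

(** The supremum over Theta dominates the average over any finite family of
signals in it, so mixture_lower_bound applies to every test. *)
Lemma minimax_risk_ge_mixture (A : R) (n : nat) (I : finType) (theta : I -> 'M[R]_N)
    (q e chi s : R) :
  (0 < #|I|)%N -> (forall i, Theta A n (theta i)) ->
  0 < q -> 0 <= e -> 0 < s -> (forall i, mxdot (theta i) (theta i) = q) ->
  (forall i j, 0 <= mxdot (theta i) (theta j)) ->
  \sum_i \sum_j pair_moment q e (mxdot (theta i) (theta j))
    <= #|I|%:R ^+ 2 * (1 + chi) ->
  ((1 - (s / 2 + (chi + 2 * expR (- (e ^+ 2 * q / 2))) / (2 * s)))%:E
    <= minimax_risk A n N)%E.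
Proof.
move=> I0 thT q0 e0 s0 thq thv sumb.
set r := s / 2 + _.
apply: le_ereal_inf_tmp => _ [T _ <-].
set B := [set X : matrix_space N | T X = false].
have mB : measurable B.
  rewrite -[X in measurable X]setTI.
  exact: (@measurable_funPT _ _ _ _ T measurableT [set false]).
have mglr (i : I) : measurable_fun setT (fun X => expR (log_lr (theta i) X)).
  by apply: measurableT_comp; [exact: measurable_expR|exact: measurable_log_lr].
have g0 (i : I) X : 0 <= expR (log_lr (theta i) X) by exact: expR_ge0.
have lb := @mixture_lower_bound _ (matrix_space N) R P0 I
  (fun i => gaussian_matrix_law (theta i))
  (fun i X => expR (log_lr (theta i) X))
  (fun i => truncation (theta i) ((1 + e) * q))
  (fun i j => pair_moment q e (mxdot (theta i) (theta j)))
  (expR (- (e ^+ 2 * q / 2))) chi I0 mglr g0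
  (fun i => gaussian_matrix_lr (theta i))
  (fun i => measurable_truncation (theta i) ((1 + e) * q))
  (fun i => truncation_prob e0 (thq i))
  (fun i j => truncated_pair_moment e q0 (thv i j) (thq i) (thq j) erefl)
  sumb s B s0 mB.
rewrite /test_risk; set sup := ereal_sup _.
have sup_ge i : (gaussian_matrix_law (theta i) B <= sup)%E.
  by apply: ereal_sup_ubound; exists (theta i).
have [i0 _] : exists i0 : I, i0 \in I by apply/card_gt0P.
have [sg sgE] : exists sg : R, sup = sg%:E.
  exists (fine sup); rewrite fineK// fin_real//; apply/andP; split.
    apply: (@lt_le_trans _ _ 0%E); first exact: ltNyr.
    exact: le_trans (sup_ge i0).
  apply: (@le_lt_trans _ _ 1%E); last exact: ltry.
  by apply: ge_ereal_sup => _ [th _ <-]; exact: probability_le1.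
have avg : ((#|I|%:R^-1)%:E * \sum_i gaussian_matrix_law (theta i) B <= sup)%E.
  rewrite lee_pdivrMl ?ltr0n//.
  apply: (@le_trans _ _ (\sum_(i : I) sg%:E)%E).
    by apply: lee_sum => i _; rewrite -sgE; exact: sup_ge.
  by rewrite sumEFin sumr_const sgE -EFinM mulr_natl.
have TE : P0 [set X | T X = true] = (1 - P0 B)%E.
  rewrite (_ : [set X | T X = true] = ~` B) ?probability_setC//.
  by apply/seteqP; split => X /=; rewrite /B/=; case: (T X).
have [p pE] : exists p : R, P0 B = p%:E.
  by exists (fine (P0 B)); rewrite fineK// fin_num_measure.
have H : (p%:E - r%:E <= sup)%E.
  rewrite leeBlDr// -pE; apply: (le_trans lb).
  by rewrite leeD2r.
rewrite TE pE sgE -EFinB -EFinD lee_fin.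
move: H; rewrite sgE -EFinB lee_fin; lra.
Qed.

End bayes_bound.

(** * Overlaps of random selections *)

Section overlaps.
Context {R : realType} {n m : nat}.
Implicit Types f : {ffun 'I_n -> 'I_m}.

Definition overlap f f' : nat := #|[pred i | f i == f' i]|.

Lemma overlap_le f f' : (overlap f f' <= n)%N.
Proof. by rewrite -[leqRHS]card_ord max_card. Qed.

Lemma overlap_refl f : overlap f f = n.
Proof.
by rewrite -[RHS]card_ord; apply: eq_card => i; rewrite !inE eqxx.
Qed.

(** The generating function of a binomial(n, 1 / m) variable, times m^n: the
coordinates of a uniform random f' are independent. *)
Lemma sum_overlap_exp f (x : R) :
  \sum_(f' : {ffun 'I_n -> 'I_m}) x ^+ overlap f f' = (m%:R - 1 + x) ^+ n.
Proof.
transitivity (\sum_(f' : {ffun 'I_n -> 'I_m}) \prod_i (if f i == f' i then x else 1)).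
  apply: eq_bigr => f' _; rewrite -big_mkcond /= prodr_const.
  by congr (_ ^+ _); apply: eq_card => i; rewrite !inE.
rewrite -(bigA_distr_bigA (fun i j => if f i == j then x else 1)).
transitivity (\prod_(i < n) (m%:R - 1 + x)); last by rewrite prodr_const card_ord.
apply: eq_bigr => i _.
rewrite (bigD1 (f i))//= eqxx.
under eq_bigr => j jf do rewrite eq_sym (negbTE jf).
have -> : \sum_(j < m | j != f i) (1 : R) = m%:R - 1.
  have : \sum_(j < m) (1 : R) = m%:R by rewrite sumr_const card_ord.
  by rewrite (bigD1 (f i))//= => <-; rewrite [1 + _]addrC addrK.
by rewrite addrC.
Qed.

(** Linearity of expectation: m times the number of f' that agree with f at i is
m^n, for every i. *)
Lemma sum_overlap f : (m * \sum_(f' : {ffun 'I_n -> 'I_m}) overlap f f' = n * m ^ n)%N.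
Proof.
have -> : (\sum_(f' : {ffun 'I_n -> 'I_m}) overlap f f' = \sum_(i < n) \sum_(f' : {ffun 'I_n -> 'I_m}) (f i == f' i))%N.
  rewrite exchange_big; apply: eq_bigr => f' _.
  rewrite /overlap -sum1_card big_mkcond; apply: eq_bigr => i _ /=.
  by rewrite inE; case: eqP.
rewrite big_distrr /= -[in RHS](card_ord n) -sum_nat_const; apply: eq_bigr => i _.
transitivity (m * \sum_(f' : {ffun 'I_n -> 'I_m})
    \prod_(k < n) (if k == i then (f i == f' k : nat) else 1))%N.
  congr (_ * _)%N; apply: eq_bigr => f' _.
  rewrite (bigD1 i)//= eqxx big1 ?muln1// => k ki.
  by rewrite (negbTE ki).
rewrite -(bigA_distr_bigA (fun k j => if k == i then (f i == j : nat) else 1%N)).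
rewrite (bigD1 i)//= eqxx (bigD1 (f i))//= eqxx big1 ?addn0 ?mul1n; last first.
  by move=> j jf; rewrite eq_sym (negbTE jf).
transitivity (m * \prod_(k < n | k != i) m)%N.
  congr (_ * _)%N; apply: eq_bigr => k ki.
  by rewrite (negbTE ki) sum1_card card_ord.
rewrite prod_nat_const -expnS; congr (_ ^ _)%N.
by rewrite cardC1 card_ord prednK// (leq_trans _ (ltn_ord i)).
Qed.

(** The inverse of the Chernoff bound for the probability of the overlap k. The
maximum with 1 replaces that bound by the trivial one when k is below
exp(1) times the mean. *)
Definition overlap_weight (k : nat) : R :=
  Num.max 1 (k%:R * m%:R / (expR 1 * n%:R)) ^+ k.

Lemma overlap_weight_ge1 k : 1 <= overlap_weight k.
Proof. by rewrite exprn_ege1// le_max lexx. Qed.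

(** Each of the n + 1 values k contributes at most m^n, trivially if the
weight is 1 and else by the Markov inequality for x^overlap with x = k m / n. *)
Lemma sum_overlap_weight f : (0 < n)%N -> (0 < m)%N ->
  \sum_(f' : {ffun 'I_n -> 'I_m}) overlap_weight (overlap f f') <= n.+1%:R * m%:R ^+ n.
Proof.
move=> n0 m0.
have n0' : 0 < n%:R :> R by rewrite ltr0n.
have m0' : 0 < m%:R :> R by rewrite ltr0n.
have E : \sum_(f' : {ffun 'I_n -> 'I_m}) overlap_weight (overlap f f') =
    \sum_(k < n.+1) \sum_(f' | overlap f f' == k) overlap_weight k.
  rewrite (partition_big (fun f' => inord (overlap f f') : 'I_n.+1) xpredT)//=.
  apply: eq_bigr => k _; apply: eq_big => [f'|f' /eqP <-].
    by rewrite -val_eqE /= inordK// ltnS overlap_le.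
  by rewrite inordK// ltnS overlap_le.
rewrite E -[X in _ <= X%:R * _](card_ord n.+1) mulr_natl -sumr_const; apply: ler_sum => k _.
set x : R := k%:R * m%:R / n%:R.
have x0 : 0 <= x by rewrite divr_ge0 ?mulr_ge0.
rewrite /overlap_weight.
have [_|_] := leP 1 (_ / _); last first.
  under eq_bigr do rewrite expr1n.
  apply: (@le_trans _ _ (\sum_(f' : {ffun 'I_n -> 'I_m}) 1)).
    rewrite [leRHS](bigID (fun f' => overlap f f' == k))/= lerDl.
    exact: sumr_ge0.
  by rewrite sumr_const card_ffun !card_ord natrX.
have -> : (k%:R * m%:R / (expR 1 * n%:R)) ^+ k = x ^+ k * expR (- k%:R).
  rewrite expRN (_ : expR k%:R = expR 1 ^+ k); last by rewrite -expRM_natl mulr1.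
  rewrite -exprVn -exprMn.
  by congr (_ ^+ _); rewrite /x; field; rewrite gt_eqF ?expR_gt0//= gt_eqF.
have mgf : \sum_(f' | overlap f f' == k) x ^+ k <= m%:R ^+ n * expR k%:R.
  apply: (@le_trans _ _ (\sum_(f' : {ffun 'I_n -> 'I_m}) x ^+ overlap f f')).
    rewrite [leRHS](bigID (fun f' => overlap f f' == k))/= -[leLHS]addr0 lerD//.
      by apply: ler_sum => f' /eqP ->.
    by rewrite sumr_ge0// => f' _; rewrite exprn_ge0.
  rewrite sum_overlap_exp.
  have -> : expR k%:R = expR (x / m%:R) ^+ n :> R.
    rewrite -expRM_natl; congr expR; rewrite /x; field.
    by rewrite !gt_eqF.
  have m1 : 0 <= m%:R - 1 :> R by rewrite subr_ge0 ler1n.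
  rewrite -exprMn lerXn2r ?nnegrE ?(addr_ge0 m1 x0) ?mulr_ge0 ?expR_ge0//.
  have h := expR_ge1Dx (x / m%:R).
  apply: (@le_trans _ _ (m%:R * (1 + x / m%:R))); last by rewrite ler_wpM2l.
  rewrite mulrDr mulr1 mulrCA divff ?gt_eqF// mulr1.
  by rewrite lerD2r lerBlDr lerDl.
rewrite -mulr_suml.
apply: (le_trans (ler_wpM2r (expR_ge0 _) mgf)).
by rewrite -mulrA -expRD subrr expR0 mulr1.
Qed.

End overlaps.

(** * The block prior *)

Section block_prior.
Context {R : realType} {n m N : nat}.
Hypothesis nmN : (n * m <= N)%N.
Implicit Types f g : {ffun 'I_n -> 'I_m}.

(** Position j of block i. One selected index per block makes the overlap of two
selections a sum of independent indicators. *)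
Definition block_pos (i : 'I_n) (j : 'I_m) : 'I_N := widen_ord nmN (mxvec_index i j).

Lemma block_pos_inj i j i' j' : block_pos i j = block_pos i' j' -> (i, j) = (i', j').
Proof.
by move=> /(congr1 val) /= /val_inj /enum_rank_inj.
Qed.

Definition block_set f : {set 'I_N} := imset (fun i => block_pos i (f i)) (mem 'I_n).

Lemma block_set_inj f : injective (fun i => block_pos i (f i)).
Proof. by move=> i i' /block_pos_inj[]. Qed.

Lemma card_block_set f : #|block_set f| = n.
Proof. by rewrite card_imset ?card_ord//; exact: block_set_inj. Qed.

Lemma block_pos_in f i j : (block_pos i j \in block_set f) = (f i == j).
Proof.
apply/imsetP/eqP => [[i' _ /block_pos_inj[-> ->]]//|<-].
by exists i.
Qed.

Let u f (a : 'I_N) : R := (a \in block_set f)%:R.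

Lemma sum_block_set f f' : \sum_a u f a * u f' a = (overlap f f')%:R.
Proof.
transitivity (\sum_(a in block_set f) u f' a).
  rewrite [RHS]big_mkcond; apply: eq_bigr => a _; rewrite /u.
  by case: (a \in block_set f); rewrite ?mul1r ?mul0r.
rewrite big_imset /=; last by move=> i i' _ _; exact: block_set_inj.
rewrite /overlap -sum1_card natr_sum big_mkcond [RHS]big_mkcond.
apply: eq_bigr => i _ /=.
by rewrite /u block_pos_in inE eq_sym; case: eqP.
Qed.

Definition block_signal (A : R) (p : {ffun 'I_n -> 'I_m} * {ffun 'I_n -> 'I_m}) : 'M[R]_N :=
  \matrix_(a, b) (A * u p.1 a * u p.2 b).

Lemma block_signal_Theta A p : Theta A n (block_signal A p).
Proof.
exists (block_set p.1), (block_set p.2); split; rewrite ?card_block_set// => i j.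
  by move=> ip jp; rewrite mxE /u ip jp !mulr1.
rewrite mxE /u; case: (i \in _); case: (j \in _) => //=;
  by rewrite ?mulr0 ?mul0r.
Qed.

Lemma mxdot_block_signal A p p' : mxdot (block_signal A p) (block_signal A p') =
  A ^+ 2 * ((overlap p.1 p'.1)%:R * (overlap p.2 p'.2)%:R).
Proof.
rewrite -!sum_block_set /mxdot big_distrlr /= mulr_sumr; apply: eq_bigr => a _.
by rewrite mulr_sumr; apply: eq_bigr => b _; rewrite !mxE; ring.
Qed.

End block_prior.

Section block_bound.
Context {R : realType}.

Lemma expR_le_1D2x (y : R) : 0 <= y <= 2^-1 -> expR y <= 1 + 2 * y.
Proof.
move=> /andP[y0 y1].
have h := expR_ge1Dx (- y); rewrite expRN in h.
have e0 := expR_gt0 y.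
have h2 : (1 - y) * expR y <= 1.
  by rewrite -ler_pdivlMr// div1r.
nra.
Qed.

Lemma sum_sum_affine_product (I : finType) (a b w v : I -> R) (c d : R) :
  \sum_i \sum_j (1 + c * (a i * b j) + d * (w i * v j)) =
  #|I|%:R ^+ 2 + c * ((\sum_i a i) * \sum_j b j) + d * ((\sum_i w i) * \sum_j v j).
Proof.
transitivity (\sum_i (#|I|%:R + c * (a i * \sum_j b j) + d * (w i * \sum_j v j))).
  apply: eq_bigr => i _; rewrite !big_split /= sumr_const.
  by rewrite -!mulr_sumr.
by rewrite !big_split /= sumr_const -!mulr_sumr -!mulr_suml -[X in X + _ + _]mulr_natl expr2.
Qed.

(** With w the overlap_weight and v = A^2 k k', the moment of every pair is at
most 1 + 2 v + en w(k) w(k'): the first part covers v <= 1/2 and the last one,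
by hypothesis, the larger overlaps. Averaging over the prior gives the mean of
k k', which is (n / m)^2, and at most (n + 1)^2 for the product of the
weights. *)
Lemma minimax_risk_ge_block_prior (A e s en : R) (n m N : nat) :
  (0 < n)%N -> (0 < m)%N -> (n * m <= N)%N ->
  0 < A -> 0 <= e -> 0 < s -> 0 <= en ->
  (forall k k' : nat, (k <= n)%N -> (k' <= n)%N ->
    2^-1 < A ^+ 2 * (k%:R * k'%:R) ->
    pair_moment (A ^+ 2 * n%:R ^+ 2) e (A ^+ 2 * (k%:R * k'%:R))
      <= en * (@overlap_weight R n m k * @overlap_weight R n m k')) ->
  ((1 - (s / 2 + (2 * A ^+ 2 * (n%:R / m%:R) ^+ 2 + en * n.+1%:R ^+ 2
       + 2 * expR (- (e ^+ 2 * (A ^+ 2 * n%:R ^+ 2) / 2))) / (2 * s)))%:E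
    <= minimax_risk A n N)%E.
Proof.
move=> n0 m0 nmN A0 e0 s0 en0 bad.
have n0' : 0 < n%:R :> R by rewrite ltr0n.
have m0' : 0 < m%:R :> R by rewrite ltr0n.
apply: (minimax_risk_ge_mixture (theta := block_signal nmN A) (q := A ^+ 2 * n%:R ^+ 2)) => //.
- by rewrite card_prod !card_ffun !card_ord muln_gt0 expn_gt0 m0.
- by move=> p; exact: block_signal_Theta.
- by rewrite mulr_gt0 ?exprn_gt0.
- by move=> p; rewrite mxdot_block_signal !overlap_refl -expr2.
- by move=> p p'; rewrite mxdot_block_signal mulr_ge0 ?sqr_ge0.
set chi := 2 * _ * _ + _.
rewrite card_prod !card_ffun !card_ord.
set M : R := m%:R ^+ n.
have ME : (m ^ n * m ^ n)%:R = M ^+ 2 :> R by rewrite natrM natrX -expr2.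
have pointwise k k' : (k <= n)%N -> (k' <= n)%N ->
    pair_moment (A ^+ 2 * n%:R ^+ 2) e (A ^+ 2 * (k%:R * k'%:R)) <=
    1 + 2 * A ^+ 2 * (k%:R * k'%:R) + en * (@overlap_weight R n m k * @overlap_weight R n m k').
  move=> kn k'n.
  have w0 j : 0 <= @overlap_weight R n m j.
    exact: le_trans (overlap_weight_ge1 j).
  have v0 : 0 <= A ^+ 2 * (k%:R * k'%:R) by rewrite mulr_ge0 ?sqr_ge0.
  have [small|/(bad _ _ kn k'n) big] := leP (A ^+ 2 * (k%:R * k'%:R)) 2^-1.
    rewrite /pair_moment ge_min; apply/orP; left.
    apply: (le_trans (expR_le_1D2x _)); first by rewrite v0.
    by rewrite mulrA lerDl mulr_ge0// mulr_ge0.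
  apply: (le_trans big); rewrite lerDr -mulrA.
  by rewrite addr_ge0// mulr_ge0.
have sum_ov f : \sum_(f' : {ffun 'I_n -> 'I_m}) (overlap f f')%:R = n%:R / m%:R * M.
  have := congr1 (fun k => k%:R : R) (sum_overlap f); rewrite !natrM natrX => E.
  rewrite -natr_sum; apply: (mulfI (lt0r_neq0 m0')); rewrite E /M.
  by field; rewrite gt_eqF.
have inner p : \sum_(p' : {ffun 'I_n -> 'I_m} * {ffun 'I_n -> 'I_m})
    pair_moment (A ^+ 2 * n%:R ^+ 2) e (mxdot (block_signal nmN A p) (block_signal nmN A p'))
    <= M ^+ 2 * (1 + chi).
  apply: (@le_trans _ _ (\sum_(f' : {ffun 'I_n -> 'I_m}) \sum_(g' : {ffun 'I_n -> 'I_m})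
     (1 + 2 * A ^+ 2 * ((overlap p.1 f')%:R * (overlap p.2 g')%:R) +
       en * (@overlap_weight R n m (overlap p.1 f') * @overlap_weight R n m (overlap p.2 g'))))).
    rewrite pair_bigA /=; apply: ler_sum => -[f' g'] _.
    by rewrite mxdot_block_signal /=; apply: pointwise; exact: overlap_le.
  rewrite sum_sum_affine_product !sum_ov card_ffun !card_ord natrX -/M.
  have w1 := sum_overlap_weight (R := R) p.1 n0 m0.
  have w2 := sum_overlap_weight (R := R) p.2 n0 m0.
  have w0 j : 0 <= @overlap_weight R n m j.
    exact: le_trans (overlap_weight_ge1 j).
  have ww : (\sum_(f' : {ffun 'I_n -> 'I_m}) @overlap_weight R n m (overlap p.1 f')) *
      (\sum_(f' : {ffun 'I_n -> 'I_m}) @overlap_weight R n m (overlap p.2 f')) <=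
      (n.+1%:R * M) * (n.+1%:R * M).
    by apply: ler_pM => //; apply: sumr_ge0 => f' _; exact: w0.
  apply: (@le_trans _ _ (M ^+ 2 + 2 * A ^+ 2 * (n%:R / m%:R * M * (n%:R / m%:R * M)) +
      en * ((n.+1%:R * M) * (n.+1%:R * M)))).
    by rewrite lerD2l ler_wpM2l.
  by rewrite le_eqVlt; apply/orP; left; apply/eqP; rewrite /chi; ring.
apply: (le_trans (ler_sum _ (fun p _ => inner p))).
rewrite sumr_const card_prod !card_ffun !card_ord -[leLHS]mulr_natl ME.
by rewrite mulrA -expr2.
Qed.

End block_bound.

(** * Large overlaps are negligible *)

Section large_overlaps.
Context {R : realType}.

Lemma overlap_weight_ge (al : R) (n m k : nat) :
  (0 < n)%N -> (0 < k)%N -> expR (al * ln n%:R) / 2 <= m%:R ->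
  expR (k%:R * (ln k%:R - 2 - (1 - al) * ln n%:R)) <= @overlap_weight R n m k.
Proof.
move=> n0 k0 hm; rewrite expRM_natl /overlap_weight.
have n0' : 0 < n%:R :> R by rewrite ltr0n.
have k0' : 0 < k%:R :> R by rewrite ltr0n.
apply: lerXn2r; rewrite ?nnegrE ?expR_ge0 ?le_max ?ler01//; apply/orP; right.
have e2 : 2 <= expR 1 :> R by have := expR_ge1Dx (1 : R); lra.
have -> : ln k%:R - 2 - (1 - al) * ln n%:R =
    ln k%:R + al * ln n%:R - ln n%:R - 1 - 1 :> R by ring.
rewrite !expRB expRD !lnK ?posrE//.
set E := expR (al * ln n%:R) in hm *; set e1 := expR 1 in e2 *.
have h : E / e1 <= m%:R.
  apply: le_trans hm; rewrite ler_wpM2l ?expR_ge0// lef_pV2 ?posrE//.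
  exact: expR_gt0.
have e10 : e1 != 0 by rewrite gt_eqF// expR_gt0.
have n00 : n%:R != 0 :> R by rewrite gt_eqF.
have -> : k%:R * E / n%:R / e1 / e1 = k%:R / (e1 * n%:R) * (E / e1).
  by field; rewrite e10 n00.
have -> : k%:R * m%:R / (e1 * n%:R) = k%:R / (e1 * n%:R) * m%:R.
  by field; rewrite e10 n00.
by rewrite ler_wpM2l// divr_ge0// mulr_ge0// expR_ge0.
Qed.

Section large_overlap_cases.
(* ga is the distance of al to the critical value, eta0 separates small from
   large fractions of n and e is the slack of the truncation, chosen such that
   (1 + 2 e) (1 + de) = 1 + de / 2. The conditions c1 to c4 hold for n large. *)
Variables (al de : R) (n m : nat) (b ga eta0 e l A2 : R).
Hypotheses (bE : b = (1 + de) * al) (gaE : ga = al - 2^-1)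
  (eta0E : eta0 = ga / (16 * b)) (eE : e = - de / (4 * (1 + de)))
  (lE : l = ln n%:R) (A2E : A2 = 4 * b * l / n%:R).
Hypotheses (al_gt : 2^-1 < al) (de_gt : -1 < de) (de_lt0 : de < 0).
Hypotheses (n0 : (0 < n)%N) (l0 : 0 < l) (hm : expR (al * l) / 2 <= m%:R)
  (c1 : ln (8 * b * l) + 4 <= ga * l)
  (c2 : 8 * b * l * ((8 + 8 * al) / ga) ^+ 2 <= n%:R)
  (c3 : 2 - ln eta0 <= - de * al / 4 * l)
  (c4 : 2 + 2 * al <= 2 * eta0 * n%:R * (- de * al / 4)).

Let n0' : 0 < n%:R :> R. Proof. by rewrite ltr0n. Qed.
Let al0 : 0 < al. Proof. by apply: lt_trans al_gt; rewrite invr_gt0. Qed.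
Let de1 : 0 < 1 + de. Proof. by rewrite -ltrBlDl sub0r. Qed.
Let b0 : 0 < b. Proof. by rewrite bE mulr_gt0. Qed.
Let ga0 : 0 < ga. Proof. by rewrite gaE subr_gt0. Qed.
Let eta00 : 0 < eta0. Proof. by rewrite eta0E divr_gt0// mulr_gt0. Qed.
Let A20 : 0 < A2. Proof. by rewrite A2E divr_gt0// !mulr_gt0. Qed.

Let hmn : expR (al * ln n%:R) / 2 <= m%:R. Proof. by rewrite -lE. Qed.

(** From n < 8 b l k^2 and c1, the Chernoff bound yields at least ga l / 2 per
unit of k, of which the moment takes at most ga l / 4, by the choice of eta0;
the rest exceeds (2 + 2 al) l, since k is large by c2. *)
Lemma unbalanced_overlaps (k k' : nat) : (k' <= k)%N ->
  2^-1 < A2 * (k%:R * k'%:R) -> k'%:R <= eta0 * n%:R ->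
  expR (A2 * (k%:R * k'%:R)) <=
  expR (- (2 + 2 * al) * l) * @overlap_weight R n m k.
Proof.
move=> k'k bad k'small.
have k0 : (0 < k)%N.
  rewrite lt0n; apply/eqP => k0; move: bad; rewrite k0 mul0r mulr0.
  by rewrite ltNge invr_ge0 ler0n.
have k0' : 0 < k%:R :> R by rewrite ltr0n.
have k'kR : k'%:R <= k%:R :> R by rewrite ler_nat.
have k'0 : 0 <= k'%:R :> R by [].
have k2 : n%:R < 8 * b * l * k%:R ^+ 2.
  have h1 : A2 * (k%:R * k'%:R) <= A2 * k%:R ^+ 2.
    by rewrite ler_pM2l// expr2 ler_pM2l.
  have : 2^-1 < A2 * k%:R ^+ 2 by exact: lt_le_trans h1.
  rewrite A2E mulrAC ltr_pdivlMr//; lra.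
have bl0 : 0 < 8 * b * l by rewrite !mulr_gt0.
have lnk : l - ln (8 * b * l) <= 2 * ln k%:R.
  have := ltW k2; rewrite -ler_ln ?posrE// ?mulr_gt0 ?exprn_gt0//.
  rewrite lnM ?posrE ?exprn_gt0// lnXn// -[ln k%:R *+ 2]mulr_natl -lE; lra.
have k_ge : (8 + 8 * al) / ga <= k%:R.
  have g1 : 0 <= (8 + 8 * al) / ga by rewrite divr_ge0 ?ltW// addr_gt0// mulr_gt0.
  rewrite -(@ler_pXn2r _ 2)// ?nnegrE//.
  rewrite -(ler_pM2l bl0); apply: (le_trans c2); exact: ltW.
apply: le_trans (ler_wpM2l (expR_ge0 _) (overlap_weight_ge n0 k0 hmn)).
rewrite -expRD ler_expR -lE.
have -> : A2 * (k%:R * k'%:R) = 4 * b * l * k%:R * (k'%:R / n%:R).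
  by rewrite A2E; field; rewrite gt_eqF.
have h2 : 4 * b * l * k%:R * (k'%:R / n%:R) <= ga * l / 4 * k%:R.
  have h3 : k'%:R / n%:R <= eta0 by rewrite ler_pdivrMr.
  apply: (le_trans (ler_wpM2l _ h3)); first by rewrite !mulr_ge0 ?ltW.
  rewrite le_eqVlt; apply/orP; left; apply/eqP; rewrite eta0E.
  by field; rewrite gt_eqF.
have h4 : ga / 2 * l <= ln k%:R - 2 - (1 - al) * l by move: c1; rewrite gaE; lra.
have h5 : k%:R * (ga / 2 * l) <= k%:R * (ln k%:R - 2 - (1 - al) * l) by rewrite ler_pM2l.
have h6 : (2 + 2 * al) * l <= ga / 4 * k%:R * l.
  rewrite ler_pM2r//; move: k_ge; rewrite ler_pdivrMr//; lra.
lra.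
Qed.

(** The Chernoff bound yields al l per unit of k + k' up to a constant, and the
truncated moment takes only (1 + de / 2) al l. *)
Lemma balanced_overlaps (k k' : nat) :
  eta0 * n%:R < k%:R -> eta0 * n%:R < k'%:R ->
  expR ((1 + 2 * e) * ((A2 * n%:R ^+ 2) * (A2 * (k%:R * k'%:R)) /
     (A2 * n%:R ^+ 2 + A2 * (k%:R * k'%:R)))) <=
  expR (- (2 + 2 * al) * l) * (@overlap_weight R n m k * @overlap_weight R n m k').
Proof.
move=> kb k'b.
have kpos (j : nat) : eta0 * n%:R < j%:R -> (0 < j)%N.
  by move=> jb; rewrite -(ltr0n R); apply: lt_trans jb; rewrite mulr_gt0.
have lnb (j : nat) : eta0 * n%:R < j%:R -> l + ln eta0 <= ln j%:R.
  move=> jb; rewrite addrC lE -lnM ?posrE//.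
  by rewrite ler_ln ?posrE ?mulr_gt0// ?ltr0n ?kpos// ltW.
have wb (j : nat) : eta0 * n%:R < j%:R ->
    expR (j%:R * (al * l - 2 + ln eta0)) <= @overlap_weight R n m j.
  move=> jb; apply: le_trans (overlap_weight_ge n0 (kpos _ jb) hmn).
  rewrite ler_expR ler_wpM2l// -lE; have := lnb _ jb; lra.
apply: (@le_trans _ _ (expR (- (2 + 2 * al) * l) *
    (expR (k%:R * (al * l - 2 + ln eta0)) * expR (k'%:R * (al * l - 2 + ln eta0))))).
  rewrite -!expRD ler_expR.
  have kk0 : 0 < k%:R * k'%:R :> R by rewrite mulr_gt0 ?ltr0n ?kpos.
  have -> : (A2 * n%:R ^+ 2) * (A2 * (k%:R * k'%:R)) /
     (A2 * n%:R ^+ 2 + A2 * (k%:R * k'%:R)) =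
     4 * b * l * (n%:R * (k%:R * k'%:R) / (n%:R ^+ 2 + k%:R * k'%:R)).
    rewrite A2E; field.
    have s0 : 0 < n%:R ^+ 2 + k%:R * k'%:R :> R by rewrite addr_gt0// exprn_gt0.
    have -> : 4 * b * l * n%:R * n%:R + 4 * b * l * (k%:R * k'%:R) =
      4 * b * l * (n%:R ^+ 2 + k%:R * k'%:R) by ring.
    by rewrite !gt_eqF// !mulr_gt0.
  have h1 : n%:R * (k%:R * k'%:R) / (n%:R ^+ 2 + k%:R * k'%:R) <= (k%:R + k'%:R) / 4 :> R.
    rewrite ler_pdivrMr ?addr_gt0// ?exprn_gt0//.
    (* (k + k') (n^2 + k k') - 4 n k k' is the sum of the two terms below *)
    have q1 : 0 <= k%:R * (n%:R - k'%:R) ^+ 2 :> R by rewrite mulr_ge0 ?sqr_ge0.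
    have q2 : 0 <= k'%:R * (n%:R - k%:R) ^+ 2 :> R by rewrite mulr_ge0 ?sqr_ge0.
    lra.
  have ebE : (1 + 2 * e) * b = (1 + de / 2) * al.
    by rewrite eE bE; field; rewrite gt_eqF.
  have e0 : 0 < 1 + 2 * e.
    have : 0 < e by rewrite eE divr_gt0 ?oppr_gt0// mulr_gt0.
    lra.
  have h2 : (1 + 2 * e) * (4 * b * l * (n%:R * (k%:R * k'%:R) / (n%:R ^+ 2 + k%:R * k'%:R)))
      <= (1 + de / 2) * al * l * (k%:R + k'%:R).
    rewrite -ebE; apply: (@le_trans _ _ ((1 + 2 * e) * (4 * b * l * ((k%:R + k'%:R) / 4)))).
      by rewrite ler_pM2l// ler_pM2l// !mulr_gt0.
    by rewrite le_eqVlt; apply/orP; left; apply/eqP; field.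
  have h3 : 2 * eta0 * n%:R <= k%:R + k'%:R by lra.
  have dal : 0 < - de * al / 4 by rewrite divr_gt0// mulr_gt0// oppr_gt0.
  have h4 : (2 + 2 * al) * l <= (k%:R + k'%:R) * (- de * al / 4) * l.
    rewrite ler_pM2r//; apply: (le_trans c4); rewrite ler_pM2r//.
  have h5 : (k%:R + k'%:R) * (2 - ln eta0) <= (k%:R + k'%:R) * (- de * al / 4 * l).
    by rewrite ler_wpM2l// addr_ge0.
  lra.
rewrite ler_wpM2l ?expR_ge0//; apply: ler_pM; rewrite ?expR_ge0//; exact: wb.
Qed.

(** Moment and weights are symmetric in k and k', so k' <= k may be assumed; the
case depends on whether k' is a small fraction of n. *)
Lemma large_overlaps_bound (k k' : nat) : 2^-1 < A2 * (k%:R * k'%:R) ->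
  pair_moment (A2 * n%:R ^+ 2) e (A2 * (k%:R * k'%:R))
    <= expR (- (2 + 2 * al) * l) * (@overlap_weight R n m k * @overlap_weight R n m k').
Proof.
wlog k'k : k k' / (k' <= k)%N => [H bad|].
  have [k'k|/ltnW kk'] := leqP k' k; first exact: H.
  by rewrite [k%:R * _]mulrC [overlap_weight k * _]mulrC; apply: H => //; rewrite [k'%:R * _]mulrC.
move=> bad; have [k's|k'b] := leP (k'%:R) (eta0 * n%:R).
  rewrite /pair_moment ge_min; apply/orP; left.
  apply: (le_trans (unbalanced_overlaps k'k bad k's)).
  rewrite ler_wpM2l ?expR_ge0// ler_peMr ?overlap_weight_ge1//.
  exact: le_trans (overlap_weight_ge1 k).
rewrite /pair_moment ge_min; apply/orP; right.
apply: balanced_overlaps => //.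
by apply: (lt_le_trans k'b); rewrite ler_nat.
Qed.

End large_overlap_cases.
End large_overlaps.

(** * Growth of the logarithm and of the dimensions *)

Section eventually.
Context {R : realType}.

Lemma near_natr_ge (K : R) : \forall n \near \oo, K <= n%:R.
Proof. exact: nbhs_infty_ger. Qed.

Lemma near_ln_ge (a K : R) : 0 < a -> \forall n \near \oo, K <= a * ln n%:R.
Proof.
move=> a0; near=> n.
rewrite mulrC -ler_pdivrMr// -[leLHS]expRK.
rewrite ler_ln ?posrE ?expR_gt0//.
  by near: n; exact: near_natr_ge.
by apply: lt_le_trans (expR_gt0 (K / a)) _; near: n; exact: near_natr_ge.
Unshelve. all: by end_near.
Qed.

(** The tangent line of slope a, up to a constant: the additive term makes any
slope available. *)
Lemma ln_le_linear (a x : R) : 0 < a -> 0 < x -> ln x <= a * x - ln a.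
Proof.
move=> a0 x0; rewrite lerBrDl -lnM ?posrE//.
by apply/ltW/ln_sublinear; rewrite mulr_gt0.
Qed.

Lemma near_ln_ln_le (a c K : R) : 0 < a -> 0 < c ->
  \forall n \near \oo, ln (c * ln n%:R) + K <= a * ln n%:R.
Proof.
move=> a0 c0; near=> n.
have l0 : 0 < ln n%:R :> R.
  have : 1 <= 1 * ln n%:R :> R by near: n; exact: near_ln_ge.
  by rewrite mul1r; exact: lt_le_trans.
have ac : 0 < a / 2 / c by rewrite !divr_gt0.
have := ln_le_linear ac (mulr_gt0 c0 l0).
have -> : a / 2 / c * (c * ln n%:R) = a / 2 * ln n%:R by field; rewrite gt_eqF.
have : K - ln (a / 2 / c) <= a / 2 * ln n%:R.
  by near: n; apply: near_ln_ge; rewrite divr_gt0.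
lra.
Unshelve. all: by end_near.
Qed.

Lemma near_ln_le_natr (a K : R) : 0 < a -> 0 < K ->
  \forall n \near \oo, K * ln n%:R <= a * n%:R.
Proof.
move=> a0 K0; near=> n.
have n0 : 0 < n%:R :> R.
  have : 1 <= n%:R :> R by near: n; exact: near_natr_ge.
  exact: lt_le_trans.
have aK : 0 < a / (2 * K) by rewrite divr_gt0// mulr_gt0.
have h := ler_wpM2l (ltW K0) (ln_le_linear aK n0).
apply: (le_trans h).
have -> : K * (a / (2 * K) * n%:R - ln (a / (2 * K))) =
  a / 2 * n%:R - K * ln (a / (2 * K)) by field; rewrite gt_eqF.
have : - K * ln (a / (2 * K)) / (a / 2) <= n%:R by near: n; exact: near_natr_ge.
rewrite ler_pdivrMr ?divr_gt0//; lra.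
Unshelve. all: by end_near.
Qed.

End eventually.

Section ambient_dimension.
Context {R : realType}.
Implicit Types al : R.

Lemma natr_powR al (n : nat) : (0 < n)%N -> n%:R `^ al = expR (al * ln n%:R) :> R.
Proof. by move=> n0; rewrite /powR pnatr_eq0 eqn0Ngt n0. Qed.

Lemma ambient_dim_le al (n : nat) : (0 < n)%N ->
  (ambient_dim al n)%:R <= expR ((1 + al) * ln n%:R).
Proof.
move=> n0; rewrite -natr_powR// /ambient_dim.
by rewrite truncn_le ?powR_ge0.
Qed.

Lemma block_size_ge al (n : nat) : (0 < n)%N -> 2 <= expR (al * ln n%:R) ->
  expR (al * ln n%:R) / 2 <= (ambient_dim al n %/ n)%:R.
Proof.
move=> n0 h2; set x := expR _ in h2 *.
have n0' : 0 < n%:R :> R by rewrite ltr0n.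
have h : n%:R * x < (ambient_dim al n).+1%:R.
  have -> : n%:R * x = n%:R `^ (1 + al).
    by rewrite natr_powR// mulrDl mul1r expRD lnK ?posrE.
  exact: truncnS_gt.
have h3 : (ambient_dim al n).+1%:R <= ((ambient_dim al n %/ n).+1 * n)%:R :> R.
  by rewrite ler_nat; exact: ltn_ceil.
have : x < (ambient_dim al n %/ n).+1%:R.
  rewrite -(ltr_pM2r n0') mulrC -natrM; exact: lt_le_trans h3.
rewrite -natr1; lra.
Qed.

End ambient_dimension.

(** * The order of the risk *)

Section risk_rate.
Context {R : realType}.

Definition risk_rate (al de : R) (n : nat) : R :=
  Num.sqrt ((1 + de) * al) * n%:R `^ (2^-1 - al) * Num.sqrt (ln n%:R).

Lemma poly_risk_between al (n : nat) (A lo hi : R) :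
  (lo%:E <= minimax_risk A n (ambient_dim al n))%E ->
  (minimax_risk A n (ambient_dim al n) <= hi%:E)%E ->
  lo <= poly_risk al n A <= hi.
Proof.
rewrite /poly_risk; case: (minimax_risk _ _ _) => [r| |] //=.
by rewrite !lee_fin => -> ->.
Qed.

Section fixed_size.
(* l, b, ga, eta0, e and c1 to c4 are those of the large overlaps. By c5, c6
   and c7 the large overlaps and the truncated mass are at most s^2; c8 makes
   the rounding in the block size m harmless. *)
Variables (al de : R) (n : nat) (b ga eta0 e l : R).
Hypotheses (bE : b = (1 + de) * al) (gaE : ga = al - 2^-1)
  (eta0E : eta0 = ga / (16 * b)) (eE : e = - de / (4 * (1 + de)))
  (lE : l = ln n%:R).
Hypotheses (al_gt : 2^-1 < al) (de_gt : -1 < de) (de_lt0 : de < 0).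
Hypotheses (n0 : (0 < n)%N) (l0 : 0 < l)
  (c1 : ln (8 * b * l) + 4 <= ga * l)
  (c2 : 8 * b * l * ((8 + 8 * al) / ga) ^+ 2 <= n%:R)
  (c3 : 2 - ln eta0 <= - de * al / 4 * l)
  (c4 : 2 + 2 * al <= 2 * eta0 * n%:R * (- de * al / 4))
  (c5 : 1 <= 4 * b * l) (c6 : 4 <= n%:R :> R) (c7 : al <= e ^+ 2 * b * n%:R)
  (c8 : 2 <= expR (al * l)).

Let A := signal_level de al n.
Let N := ambient_dim al n.
Let m := (N %/ n)%N.
Let Q := risk_rate al de n.
Let s : R := A * n%:R / m%:R.

Let n0' : 0 < n%:R :> R. Proof. by rewrite ltr0n. Qed.
Let al0 : 0 < al. Proof. by apply: lt_trans al_gt; rewrite invr_gt0. Qed.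
Let de1 : 0 < 1 + de. Proof. by rewrite -ltrBlDl sub0r. Qed.
Let b0 : 0 < b. Proof. by rewrite bE mulr_gt0. Qed.
Let ga0 : 0 < ga. Proof. by rewrite gaE subr_gt0. Qed.
Let nE : n%:R = expR l. Proof. by rewrite lE lnK ?posrE. Qed.

Let A2E : A ^+ 2 = 4 * b * l / n%:R.
Proof.
rewrite /A /signal_level -lE sqr_sqrtr.
  by rewrite bE !mulrA.
by rewrite divr_ge0// !mulr_ge0// ltW.
Qed.

Let A0 : 0 < A.
Proof.
by rewrite /A /signal_level sqrtr_gt0 -lE divr_gt0// !mulr_gt0.
Qed.

Let Q2E : Q ^+ 2 = b * l * (n%:R * expR (- (2 * al * l))).
Proof.
rewrite /Q /risk_rate natr_powR// -lE -bE !exprMn !sqr_sqrtr ?ltW// nE.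
rewrite -expRD -expRM_natl mulrAC; congr (_ * expR _).
by field.
Qed.

Lemma risk_rate_gt0 : 0 < Q.
Proof. by rewrite /Q /risk_rate natr_powR// -lE -bE !mulr_gt0 ?sqrtr_gt0 ?expR_gt0. Qed.
Let Q0 := risk_rate_gt0.

Let AQ : A * n%:R * expR (- (al * l)) = 2 * Q.
Proof.
have p1 : 0 <= A * n%:R * expR (- (al * l)).
  by rewrite mulr_ge0 ?expR_ge0// mulr_ge0// ltW.
have p2 : 0 <= 2 * Q by rewrite mulr_ge0// ltW.
apply/eqP; rewrite -(@eqrXn2 _ 2 _ _ isT p1 p2).
have -> : (2 * Q) ^+ 2 = 4 * Q ^+ 2 by ring.
rewrite Q2E !exprMn A2E -expRM_natl; apply/eqP.
have -> : 2%:R * - (al * l) = - (2 * al * l) by ring.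
by field; rewrite gt_eqF.
Qed.

Let NR_le : N%:R <= n%:R * expR (al * l).
Proof. by rewrite nE -expRD lE -[X in X + _]mul1r -mulrDl; exact: ambient_dim_le. Qed.

Let m_ge : expR (al * l) / 2 <= m%:R.
Proof. by rewrite lE; apply: block_size_ge; rewrite -?lE. Qed.

Let m0' : 0 < m%:R :> R.
Proof. by apply: lt_le_trans m_ge; rewrite divr_gt0 ?expR_gt0. Qed.

Let nmN : (n * m <= N)%N. Proof. by rewrite mulnC leq_divM. Qed.

Let m_le : m%:R <= expR (al * l).
Proof.
rewrite -(ler_pM2l n0'); apply: le_trans NR_le.
by rewrite -natrM ler_nat.
Qed.

Let s0 : 0 < s. Proof. by rewrite divr_gt0// mulr_gt0. Qed.

Let s_le : s <= 4 * Q.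
Proof.
have -> : 4 * Q = A * n%:R * (2 * expR (- (al * l))).
  rewrite (_ : A * n%:R * (2 * _) = 2 * (A * n%:R * expR (- (al * l)))); last by ring.
  by rewrite AQ; ring.
rewrite /s ler_pM2l ?mulr_gt0// expRN -[leRHS]invrK lef_pV2 ?posrE//; last first.
  by rewrite invr_gt0 mulr_gt0 ?invr_gt0 ?expR_gt0.
by rewrite invfM invrK mulrC.
Qed.

Let s_ge : 2 * Q <= s.
Proof.
rewrite -AQ /s ler_pM2l ?mulr_gt0// expRN lef_pV2 ?posrE ?expR_gt0//.
Qed.

Let s2_ge : n%:R * expR (- (2 * al * l)) <= s ^+ 2.
Proof.
apply: (@le_trans _ _ ((2 * Q) ^+ 2)); last first.
  by rewrite ler_pXn2r// nnegrE ltW// mulr_gt0.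
rewrite exprMn Q2E; set x := n%:R * _.
have x0 : 0 <= x by rewrite mulr_ge0 ?expR_ge0.
have : x * 1 <= x * (4 * b * l) by rewrite ler_wpM2l.
lra.
Qed.

(** The choice s = A n / m balances s / 2 against the second moment, which is of
the order of s^2. *)
Lemma minimax_risk_lower : ((1 - 10 * Q)%:E <= minimax_risk A n N)%E.
Proof.
have m0 : (0 < m)%N by rewrite -(ltr0n R).
have e0 : 0 < e by rewrite eE divr_gt0 ?oppr_gt0// mulr_gt0.
have bad (k k' : nat) := @large_overlaps_bound R al de n m b ga eta0 e l (A ^+ 2)
  bE gaE eta0E eE lE A2E al_gt de_gt de_lt0 n0 l0 m_ge c1 c2 c3 c4 k k'.
have := @minimax_risk_ge_block_prior R A e s (expR (- (2 + 2 * al) * l)) n m N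
  n0 m0 nmN A0 (ltW e0) s0 (expR_ge0 _) (fun k k' _ _ => bad k k').
apply: le_trans; rewrite lee_fin lerD2l lerN2.
have -> : 2 * A ^+ 2 * (n%:R / m%:R) ^+ 2 = 2 * s ^+ 2.
  by rewrite /s; field; rewrite gt_eqF.
set t1 := expR _ * _; set t2 := 2 * expR _.
have x0 : 0 < expR (- (2 * al * l)) by exact: expR_gt0.
have h1 : t1 <= s ^+ 2.
  apply: le_trans s2_ge.
  rewrite /t1; have -> : - (2 + 2 * al) * l = - (2 * al * l) - (l + l) by ring.
  rewrite expRB expRD -nE mulrAC -[leRHS]mulrC -mulrA ler_wpM2l ?(ltW x0)//.
  rewrite ler_pdivrMr ?mulr_gt0//.
  have y1 : n.+1%:R <= 2 * n%:R :> R by have := c6; rewrite -(natr1 n); lra.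
  have y2 : n.+1%:R ^+ 2 <= (2 * n%:R) ^+ 2 :> R by apply: lerXn2r; rewrite ?nnegrE ?mulr_ge0.
  apply: (le_trans y2).
  have y3 : 4 * (n%:R * n%:R) <= n%:R * (n%:R * n%:R) :> R.
    by rewrite ler_pM2r// mulr_gt0.
  have -> : (2 * n%:R) ^+ 2 = 4 * (n%:R * n%:R) :> R by ring.
  exact: y3.
have h2 : t2 <= s ^+ 2.
  apply: le_trans s2_ge; rewrite /t2.
  apply: ler_pM => //; rewrite ?expR_ge0//.
    by apply: le_trans c6; rewrite ler_nat.
  rewrite ler_expR lerN2 A2E.
  have -> : e ^+ 2 * (4 * b * l / n%:R * n%:R ^+ 2) / 2 = 2 * (e ^+ 2 * b * n%:R) * l.
    by field; rewrite gt_eqF.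
  by rewrite ler_pM2r// ler_pM2l.
apply: (@le_trans _ _ (s / 2 + (2 * s ^+ 2 + s ^+ 2 + s ^+ 2) / (2 * s))).
  have s20 : 0 < 2 * s by rewrite pmulr_rgt0.
  by rewrite lerD2l ler_pM2r ?invr_gt0// lerD// lerD2l.
have -> : s / 2 + (2 * s ^+ 2 + s ^+ 2 + s ^+ 2) / (2 * s) = 5 / 2 * s.
  by field; rewrite gt_eqF.
by have := s_le; lra.
Qed.

(** As A n^2 / N >= 2 Q and 2 Q <= 1, the bound 1 - exp (- 2 Q) >= Q applies to
the gain of the sum test. *)
Lemma minimax_risk_upper : (minimax_risk A n N <= (1 - gap_const * Q)%:E)%E.
Proof.
have m0 : (0 < m)%N by rewrite -(ltr0n R).
have N0 : (0 < N)%N by rewrite (leq_trans _ nmN)// muln_gt0 n0.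
have N0' : 0 < N%:R :> R by rewrite ltr0n.
have := @minimax_risk_le_sum_test R A n N (ltW A0) N0.
move/le_trans; apply; rewrite lee_fin lerD2l lerN2 ler_pM2l ?gap_const_gt0//.
have Q1 : 2 * Q <= 1.
  have p2 : 0 <= 2 * Q by rewrite pmulr_rge0// ltW.
  rewrite -(@ler_pXn2r _ 2 isT (2 * Q) 1)//; last by rewrite nnegrE.
  rewrite expr1n.
  have -> : (2 * Q) ^+ 2 = 4 * Q ^+ 2 by ring.
  rewrite Q2E.
  have bl0 : 0 < 8 * b * l by rewrite !mulr_gt0.
  have h : 8 * b * l <= expR (2 * ga * l).
    rewrite -[leLHS]lnK ?posrE// ler_expR.
    have : 0 < ga * l by rewrite mulr_gt0.
    by have := c1; lra.
  have -> : n%:R * expR (- (2 * al * l)) = expR (- (2 * ga * l)).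
    by rewrite nE -expRD gaE; congr expR; field.
  have := ler_wpM2r (expR_ge0 (- (2 * ga * l))) h.
  rewrite -expRD subrr expR0.
  have : 0 < b * l * expR (- (2 * ga * l)) by rewrite !mulr_gt0 ?expR_gt0.
  lra.
have h1 : expR (- (A * n%:R ^+ 2 / N%:R)) <= expR (- (2 * Q)).
  rewrite ler_expR lerN2 -AQ expr2 mulrA -[leRHS]mulrA ler_wpM2l ?mulr_ge0 ?(ltW A0)//.
  rewrite expRN ler_pdivlMr// mulrC ler_pdivrMr ?expR_gt0//.
have h2 := expR_ge1Dx (2 * Q).
have E0 := expR_gt0 (- (2 * Q)).
have h3 : expR (- (2 * Q)) * (1 + 2 * Q) <= 1.
  apply: (le_trans (ler_wpM2l (ltW E0) h2)).
  by rewrite -expRD addNr expR0.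
have h4 : expR (- (2 * Q)) <= 1 - Q.
  have Q00 := Q0.
  have : 1 <= (1 - Q) * (1 + 2 * Q) by nra.
  move=> h5; have := le_trans h3 h5.
  by rewrite ler_pM2r//; lra.
lra.
Qed.

End fixed_size.
End risk_rate.

Lemma near_risk_bounds (R : realType) (al de : R) :
  2^-1 < al -> -1 < de -> de < 0 ->
  \forall n \near \oo, [/\ (0 < n)%N, 1 <= ln n%:R :> R, 0 < risk_rate al de n &
    gap_const * risk_rate al de n <=
      1 - poly_risk al n (signal_level de al n) <= 10 * risk_rate al de n].
Proof.
move=> al_gt de_gt de_lt0.
have al0 : 0 < al by apply: lt_trans al_gt; rewrite invr_gt0.
have de1 : 0 < 1 + de by rewrite -ltrBlDl sub0r.
set b := (1 + de) * al; have b0 : 0 < b by rewrite mulr_gt0.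
set ga := al - 2^-1; have ga0 : 0 < ga by rewrite subr_gt0.
set eta0 := ga / (16 * b); have eta00 : 0 < eta0 by rewrite divr_gt0// mulr_gt0.
set e := - de / (4 * (1 + de)).
have e0 : 0 < e by rewrite divr_gt0 ?oppr_gt0// mulr_gt0.
have dal : 0 < - de * al / 4 by rewrite divr_gt0// mulr_gt0// oppr_gt0.
have K0 : 0 < 8 * b * ((8 + 8 * al) / ga) ^+ 2.
  have b80 : 0 < 8 * b by rewrite mulr_gt0.
  by rewrite mulr_gt0// exprn_gt0// divr_gt0// addr_gt0// mulr_gt0.
near=> n.
have n4 : 4 <= n%:R :> R by near: n; exact: near_natr_ge.
have n0 : (0 < n)%N by rewrite -(ltr0n R); exact: lt_le_trans n4.
have l1 : 1 <= ln n%:R :> R.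
  by rewrite -[leRHS]mul1r; near: n; exact: near_ln_ge.
have l0 : 0 < ln n%:R :> R by exact: lt_le_trans l1.
have c1 : ln (8 * b * ln n%:R) + 4 <= ga * ln n%:R.
  by near: n; apply: near_ln_ln_le => //; rewrite mulr_gt0.
have c2 : 8 * b * ln n%:R * ((8 + 8 * al) / ga) ^+ 2 <= n%:R.
  rewrite mulrAC -[leRHS]mul1r.
  by near: n; exact: near_ln_le_natr.
have c3 : 2 - ln eta0 <= - de * al / 4 * ln n%:R.
  by near: n; exact: near_ln_ge.
have c4 : 2 + 2 * al <= 2 * eta0 * n%:R * (- de * al / 4).
  rewrite mulrAC -ler_pdivrMl; last by rewrite (mulr_gt0 _ dal)// mulr_gt0.
  by near: n; exact: near_natr_ge.
have c5 : 1 <= 4 * b * ln n%:R.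
  by near: n; apply: near_ln_ge; rewrite mulr_gt0.
have c7 : al <= e ^+ 2 * b * n%:R.
  rewrite -ler_pdivrMl; last by rewrite mulr_gt0// exprn_gt0.
  by near: n; exact: near_natr_ge.
have c8 : 2 <= expR (al * ln n%:R).
  apply: le_trans (expR_ge1Dx _).
  have : 1 <= al * ln n%:R by near: n; exact: near_ln_ge.
  lra.
split => //; first exact: (risk_rate_gt0 erefl erefl al_gt de_gt n0 l0).
have lo := minimax_risk_lower erefl erefl erefl erefl erefl al_gt de_gt de_lt0
  n0 l0 c1 c2 c3 c4 c5 n4 c7 c8.
have hi := minimax_risk_upper erefl erefl erefl al_gt de_gt n0 l0 c1 c8.
have := poly_risk_between lo hi.
lra.
Unshelve. all: by end_near.
Qed.

Theorem theorem2p4 (R : realType) :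
  exists c C : R, 0 < c /\ 0 < C /\
  forall alpha delta : R, 2^-1 < alpha -> -1 < delta -> delta < 0 ->
    (ln (1 - poly_risk alpha n (signal_level delta alpha n)) / ln n%:R
       @[n --> \oo] --> 2^-1 - alpha)
    /\
    (exists n0 : nat, forall n : nat, (n0 <= n)%N ->
       c <= (1 - poly_risk alpha n (signal_level delta alpha n)) /
              (Num.sqrt ((1 + delta) * alpha) * n%:R `^ (2^-1 - alpha)
               * Num.sqrt (ln n%:R)) <= C).
Proof.
exists gap_const, 10; split; first exact: gap_const_gt0; split => //.
move=> al de al_gt de_gt de_lt0.
have near_bounds := near_risk_bounds al_gt de_gt de_lt0.
split; last first.
  have [n0 _ bounds] := near_bounds; exists n0 => n n0n.
  have [_ _ Q0 lohi] := bounds n n0n.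
  by rewrite ler_pdivlMr// ler_pdivrMr.
have al0 : 0 < al by apply: lt_trans al_gt; rewrite invr_gt0.
have de1 : 0 < 1 + de by rewrite -ltrBlDl sub0r.
set b := (1 + de) * al; have b0 : 0 < b by rewrite mulr_gt0.
(* ln of the rate is (1/2 - al) l up to a constant and ln (sqrt l), which lies
   between 0 and ln l and is thus at most eps l for n large. *)
apply/cvgrPdist_le => eps eps0; near=> n.
have [n0 l1 Q0 /andP[lo hi]] : [/\ (0 < n)%N, 1 <= ln n%:R :> R, 0 < risk_rate al de n &
    gap_const * risk_rate al de n <=
      1 - poly_risk al n (signal_level de al n) <= 10 * risk_rate al de n].
  by near: n; exact: near_bounds.
have e1 : - (ln gap_const + ln (Num.sqrt b)) <= eps * ln n%:R.
  by near: n; exact: near_ln_ge.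
have e2 : ln (1 * ln n%:R) + (ln 10 + ln (Num.sqrt b)) <= eps * ln n%:R.
  by near: n; exact: near_ln_ln_le.
set x := 1 - _ in lo hi *; set l := ln n%:R in l1 e1 e2 *.
have l0 : 0 < l by exact: lt_le_trans l1.
have x0 : 0 < x by apply: lt_le_trans lo; rewrite mulr_gt0// gap_const_gt0.
have lnQ : ln (risk_rate al de n) =
    ln (Num.sqrt b) + (2^-1 - al) * l + ln (Num.sqrt l).
  rewrite /risk_rate natr_powR// -/b -/l.
  by rewrite !lnM ?posrE ?mulr_gt0 ?sqrtr_gt0 ?expR_gt0// expRK.
have ln_l : 0 <= ln (Num.sqrt l) <= ln l.
  have s1 : 1 <= Num.sqrt l by rewrite -[leLHS]sqrtr1 ler_wsqrtr.
  rewrite ln_ge0//= ler_ln ?posrE ?sqrtr_gt0//.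
  by rewrite -[leRHS]sqr_sqrtr ?(ltW l0)// expr2 ler_peMr ?sqrtr_ge0.
have lo' : ln gap_const + ln (risk_rate al de n) <= ln x.
  by rewrite -lnM ?posrE ?gap_const_gt0// ler_ln ?posrE// mulr_gt0 ?gap_const_gt0.
have hi' : ln x <= ln 10 + ln (risk_rate al de n).
  by rewrite -lnM ?posrE// ler_ln ?posrE// mulr_gt0.
rewrite mul1r in e2.
have -> : 2^-1 - al - ln x / l = ((2^-1 - al) * l - ln x) / l.
  by field; rewrite gt_eqF.
rewrite normrM normfV (gtr0_norm l0) ler_pdivrMr// ler_norml.
move: ln_l => /andP[ll1 ll2].
rewrite lnQ in lo' hi'.
apply/andP; split; lra.
Unshelve. all: by end_near.
Qed.
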